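(* There exists a universal constant $c\in(0,\infty)$ such that for every real $p\ge 1$ and every $\varepsilon\in(0,\infty)$, every compact metric space $X$ contains a closed subset $S\subseteq X$ that embeds with distortion $2+\varepsilon$ in $\ell_p$, and $$\dim_H(S)\ \geq\ \frac{c\,\varepsilon}{\log(1/\varepsilon)}\,\dim_H(X).$$
   Context: A metric space $(X,d_X)$ is said to be embedded with distortion $D\ge 1$ in a metric space $(Y,d_Y)$ if there exist a map $f:X\to Y$ and a constant $r>0$ such that $r\,d_X(x,y)\le d_Y(f(x),f(y))\le D\,r\,d_X(x,y)$ for all $x,y\in X$. $\dim_H$ denotes Hausdorff dimension (of a metric space; subsets carry the restricted metric). For real $p\ge1$, $\ell_p$ denotes the usual Banach space of $p$-summable real sequences with the norm $\|a\|_p=(\sum_n|a_n|^p)^{1/p}$.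
   Formalization: The factor cε/log(1/ε) is evaluated at min(ε,1/2) instead of ε, for all ε>0: as stated it tends to infinity as ε→1 from below, which is impossible for X=[0,1], and it is undefined at ε=1; for ε≤1/2 the bound is the stated one. *)

(* Defs.v *)
From HB Require Import structures.
From mathcomp Require Import all_boot all_order all_algebra finmap.
From mathcomp Require Import all_classical all_reals all_analysis.
Set Implicit Arguments.
Unset Strict Implicit.
Unset Printing Implicit Defensive.
Import Order.TTheory GRing.Theory Num.Theory.
Import numFieldNormedType.Exports.

Local Open Scope classical_set_scope.
Local Open Scope ring_scope.

Section hausdorff_dimension.
Context {R : realType} {X : metricType R}.
Implicit Types (A : set X) (s delta : R).
Local Open Scope ereal_scope.

(* [ediam set0 = -oo]; [hausdorff_gauge] therefore treats set0 separately. *)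
Definition ediam A : \bar R :=
  ereal_sup [set (mdist z.1 z.2)%:E | z in A `*` A].

(* For s = 0 a nonempty set counts 1, even if its diameter is 0, since
   0 `^ 0 = 1; the empty set always counts 0. *)
Definition hausdorff_gauge s A : \bar R :=
  if A == set0 then 0 else ediam A `^ s.

(* The covering sets range over all subsets of X; replacing each F n by
   F n `&` A shows that this depends only on the restricted metric of A. *)
Definition hausdorff_premeasure s delta A : \bar R :=
  ereal_inf [set \sum_(n <oo) hausdorff_gauge s (F n) |
    F in [set F : (set X)^nat | A `<=` \bigcup_n F n /\
                                forall n, ediam (F n) <= delta%:E]].

Definition hausdorff_measure s A : \bar R :=
  ereal_sup [set hausdorff_premeasure s delta A |
    delta in [set delta : R | (0 < delta)%R]].

(* +oo if no Hausdorff measure of A vanishes. *)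
Definition hausdorff_dim A : \bar R :=
  ereal_inf [set s%:E |
    s in [set s : R | (0 <= s)%R /\ hausdorff_measure s A = 0]].

End hausdorff_dimension.

(* The target type is nonempty in all uses, so maps defined on all of X and
   maps defined on the subset S only give the same notion. *)
Definition embeds_with_distortion {R : realType} {X : metricType R}
    (S : set X) (Y : metricType R) (D : R) : Prop :=
  exists (f : X -> Y) (r : R), 0 < r /\
    forall x y, S x -> S y ->
      r * mdist x y <= mdist (f x) (f y) <= D * r * mdist x y.

Section ellp.
Context {R : realType} (p : R) (p1 : 1 <= p).

Lemma ellp_exponent_ge1 : (1 <= p%:E)%E. Proof. by rewrite lee_fin. Qed.

(* Every function on nat is measurable and only set0 is negligible for the
   counting measure, so no quotient is needed: these are exactly the sequences
   with a finite p-norm (see ellp_mdistE for the series form). *)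
Definition ellp : Type :=
  LfunType (counting : {measure set nat -> \bar R}) ellp_exponent_ge1.

HB.instance Definition _ := Choice.on ellp.
HB.instance Definition _ := GRing.Lmodule.on ellp.

Definition ellp_norm (a : ellp) : R :=
  fine (Lnorm (counting : {measure set nat -> \bar R}) p%:E (EFin \o a)).

Definition ellp_dist (a b : ellp) : R := ellp_norm (a - b).

Let ellp_distxx a : ellp_dist a a = 0.
Proof.
rewrite /ellp_dist subrr /ellp_norm.
rewrite (_ : EFin \o _ = cst 0%E) ?Lnorm0//.
by rewrite gt_eqF// (lt_le_trans _ ellp_exponent_ge1).
Qed.

Let ellp_dist_positivity a b : ellp_dist a b = 0 -> a = b.
Proof.
move=> /fine_Lnormr_eq0 [N [_ N0 subN]].
have {}N0 : N = set0.
  apply/eqP/negPn/negP => /set0P[n Nn].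
  have : ((counting [set n] : \bar R) <= counting N)%E.
    by apply: le_measure; rewrite ?inE// => _ ->.
  rewrite N0 /counting asboolT ?finite_set1// fset_set1 cardfs1 lee_fin.
  by rewrite ler10.
apply/LfuneqP => n; apply/eqP; rewrite -subr_eq0; apply/eqP.
have [//|abn] := pselect ((a - b : ellp) n = 0).
by have : N n by [apply: subN => /= /(_ I)]; rewrite N0.
Qed.

Let ellp_dist_sym a b : ellp_dist a b = ellp_dist b a.
Proof. by rewrite /ellp_dist -opprB; exact: LnormrN. Qed.

Let ellp_dist_triangle b a c :
  ellp_dist a c <= ellp_dist a b + ellp_dist b c.
Proof.
rewrite /ellp_dist [X in ellp_norm X <= _](_ : a - c = (a - b) + (b - c)).
  exact: ler_LnormD.
by rewrite addrA subrK.
Qed.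

HB.instance Definition _ := isMetric.Build R ellp
  ellp_distxx ellp_dist_positivity ellp_dist_sym ellp_dist_triangle.

Lemma ellp_mdistE (a b : ellp) :
  (mdist a b)%:E =
    ((\sum_(n <oo) (`|a n - b n| `^ p)%:E) `^ p^-1)%E.
Proof.
by rewrite [LHS]finite_norm_fine Lnorm_counting ?(lt_le_trans ltr01).
Qed.

End ellp.

(* Main.v *)
Require Import Defs.
From mathcomp Require Import all_boot all_order all_algebra.
From mathcomp Require Import all_classical all_reals all_analysis.
From mathcomp Require Import ring lra.
Import Order.TTheory GRing.Theory Num.Theory.
Import numFieldNormedType.Exports.

Local Open Scope classical_set_scope.
Local Open Scope ring_scope.

Set Implicit Arguments.
Unset Strict Implicit.

(** Fix scales [rad k = R0 * tau ^ k] and write [chain_bounded S D] when every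
chain in [S] with steps of length at most [rho] has its ends at distance at most
[D * rho]; up to a factor [lam] arbitrarily close to 1 this is the same as
embedding [S] in an ultrametric space, hence in [ellp], with distortion [D].

Let [tau ^ (H + 1) + a <= tau] and [D = 2 / a].  If a set of radius [rad k] is
covered greedily by balls of radius [rad k.+1] and only the concentric balls of
radius [rad (k.+1 + H)] are kept, the kept pieces are [a * rad k]-separated in a
set of diameter at most [2 * rad k].  Branching like this at most once every
[H + 1] levels, and descending to the best sub-ball otherwise, produces a
[chain_bounded] set carrying a measure of mass [w ^ (1 / (H + 1))] for any
subadditive [w], and of mass at most [W ^ (1 / (H + 1))] on small pieces.  Taking
for [w] the Hausdorff content of exponent [s] on finer and finer nets, a limit
along an ultrafilter is a closed set of positive content of exponent
[s / (H + 1)], and the parameters can be chosen so that [H + 1] is of order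
[log (1 / e) / e].  When the dimension is infinite, this is applied to sets of
growing dimension located in thin lacunary shells around a single point. *)

(** * Ramsey subsets of finite metric spaces *)

Definition chain_bounded (R : realType) (T : Type) (d : T -> T -> R)
    (S : T -> Prop) (D : R) :=
  forall (rho : R) (n : nat) (u : nat -> T), 0 <= rho ->
    (forall i, (i <= n)%N -> S (u i)) ->
    (forall i, (i < n)%N -> d (u i) (u i.+1) <= rho) ->
    d (u 0%N) (u n) <= D * rho.

Section finite_fragmentation.
Import mathcomp.boot.fintype mathcomp.boot.finset.
Local Open Scope set_scope.
Local Open Scope ring_scope.
Variables (R : realType) (T : finType) (d : T -> T -> R).
Implicit Types A C E P Q S : {set T}.
Hypothesis dxx : forall x, d x x = 0.
Hypothesis dC : forall x y, d x y = d y x.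
Hypothesis dtri : forall y x z, d x z <= d x y + d y z.
Variables (w : {set T} -> R) (rad W : nat -> R) (a D : R) (H K : nat).
Hypothesis w0 : w set0 = 0.
Hypothesis w_ge0 : forall A, 0 <= w A.
Hypothesis wU : forall A B, w (A :|: B) <= w A + w B.
Hypothesis H_gt0 : (0 < H)%N.
Hypothesis rad_ge0 : forall k, 0 <= rad k.
Hypothesis rad_decr : forall k l, (k <= l)%N -> rad l <= rad k.
Hypothesis rad_sep : forall k, rad (k.+1 + H)%N + a * rad k <= rad k.+1.
Hypothesis aD : 2 <= D * a.
Hypothesis D_ge0 : 0 <= D.

(** The centre ranges over all points rather than over [C], so subsets inherit the property. *)
Definition inball k (C : {set T}) :=
  [exists c, [forall y in C, d c y <= rad k]].

Hypothesis W_decr : forall k l, (k <= l)%N -> W l <= W k.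
Hypothesis wW : forall k C, inball k C -> w C <= W k.

Let root (x : R) := x `^ H.+1%:R^-1.

Let root_ge0 x : 0 <= root x. Proof. exact: powR_ge0. Qed.

Let root_le x y : 0 <= x -> x <= y -> root x <= root y.
Proof.
move=> x0 xy; apply: ge0_ler_powR => //; rewrite nnegrE//.
exact: le_trans xy.
Qed.

Let rootK x : 0 <= x -> root x ^+ H.+1 = x.
Proof.
by move=> x0; rewrite -powR_mulrn// -powRrM mulVf ?powRr1// pnatr_eq0.
Qed.

Let W_ge0 k C : inball k C -> 0 <= W k.
Proof. by move=> /wW; exact: le_trans. Qed.

(* The index j is the number of levels below k before the first branching:
   the mass sitting in S has been bounded by W at most H - j levels above k. *)
Record good k j (C S : {set T}) (nu : T -> R) : Prop := Good {
  good_sub : S \subset C ;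
  good_neq0 : C != set0 -> S != set0 ;
  good_ge0 : forall x, 0 <= nu x ;
  good_supp : forall x, x \notin S -> nu x = 0 ;
  good_chain : chain_bounded d (fun x => x \in S) D ;
  good_loc : exists c, forall y, y \in S -> d c y <= rad (k + j)%N ;
  good_cap : forall m (A : {set T}), (k + j <= m <= K)%N ->
    (forall x y, x \in A -> y \in A -> d x y < a * rad m) ->
    \sum_(x in A) nu x <= root (W (m - H)%N) ;
  good_top : j = H -> \sum_x nu x <= root (W k) }.

Let le_mass (nu : T -> R) (A : {set T}) : (forall x, 0 <= nu x) ->
  \sum_(x in A) nu x <= \sum_x nu x.
Proof.
by move=> nu0; rewrite [leRHS](bigID (mem A))/= lerDl sumr_ge0.
Qed.

(** Passing to the coarser level with one more unit of delay leaves the absolute level [k + j]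
    unchanged; only the bound on the total mass at delay [H] is new. *)
Let good_up k j C Q S nu : good k.+1 j Q S nu -> Q \subset C -> Q != set0 ->
  (j.+1 = H -> \sum_x nu x <= root (W k)) -> good k j.+1 C S nu.
Proof.
case=> SQ S0 nu0 supp ch loc cap top QC Q0 topk; split => //.
- exact: subset_trans QC.
- by move=> _; exact: S0.
- by rewrite addnS -addSn.
- by move=> m A; rewrite addnS -addSn; exact: cap.
Qed.

(** At delay [H] the total mass is at most [root (W k)], and [W k <= W (m - H)] when [m < k + H];
    this supplies the levels [m] that a smaller delay adds. *)
Let good_reset k j C S nu : inball k C -> good k H C S nu -> (j <= H)%N ->
  good k j C S nu.
Proof.
move=> kC [SC S0 nu0 supp ch [c loc] cap top] jH; split => //.
- exists c => y yS; apply: le_trans (loc _ yS) _.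
  by apply: rad_decr; rewrite leq_add2l.
- move=> m A /andP[jm mK] Am; have [km|mk] := leqP (k + H) m.
    by apply: cap => //; rewrite km.
  apply: le_trans (le_mass _ nu0) _; apply: le_trans (top erefl) _.
  apply: root_le; first exact: W_ge0 kC.
  by apply: W_decr; rewrite leq_subLR addnC ltnW.
- by move=> _; exact: top.
Qed.

Let good_scale k j C S nu l : good k j C S nu -> 0 <= l <= 1 ->
  good k j C S (fun x => l * nu x).
Proof.
case=> SC S0 nu0 supp ch loc cap top /andP[l0 l1].
have lsum (P : pred T) : \sum_(x | P x) l * nu x <= \sum_(x | P x) nu x.
  by apply: ler_sum => x _; rewrite ler_piMl.
split => //.
- by move=> x; rewrite mulr_ge0.
- by move=> x xS; rewrite supp// mulr0.
- by move=> m A jm Am; apply: le_trans (cap m A jm Am).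
- by move=> jH; apply: le_trans (top jH).
Qed.

Let inball1 k x : inball k [set x].
Proof.
apply/existsP; exists x; apply/forallP => y; apply/implyP; rewrite inE => /eqP->.
by rewrite dxx.
Qed.

Section branching.
Variables (k : nat) (V : {set T} -> nat -> R) (C : {set T}) (M : nat -> R).
Hypothesis V_good : forall Q j, inball k.+1 Q -> (j <= H)%N ->
  exists S nu, good k.+1 j Q S nu /\ \sum_x nu x = V Q j.
Hypothesis V_prod : forall Q, inball k.+1 Q -> w Q <= \prod_(j < H.+1) V Q j.
Hypothesis M_max : forall Q j, Q != set0 -> Q \subset C -> inball k.+1 Q ->
  (j <= H)%N -> V Q j <= M j.

Let V_ge0 Q j : inball k.+1 Q -> (j <= H)%N -> 0 <= V Q j.
Proof.
by move=> kQ jH; have [S [nu [g <-]]] := V_good kQ jH; apply: sumr_ge0 => x _;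
  exact: (good_ge0 g).
Qed.

Lemma exists_max (E : {set T}) j : E != set0 -> exists Q,
  [/\ Q != set0, Q \subset E, inball k.+1 Q &
    forall P, P != set0 -> P \subset E -> inball k.+1 P -> V P j <= V Q j].
Proof.
move=> /set0Pn[x xE].
pose p (Q : {set T}) := [&& Q != set0, Q \subset E & inball k.+1 Q].
have px : p [set x].
  by rewrite /p sub1set xE inball1 andbT/= andbT; apply/set0Pn; exists x; rewrite inE.
case: (Order.TotalTheory.arg_maxP (fun Q => V Q j) px) => Q /and3P[Q0 QE kQ] Qmax.
by exists Q; split => // P P0 PE kP; apply: Qmax; rewrite /p P0 PE.
Qed.

(** Greedy induction on [#|E|]. The sub-ball [Q] maximizes [V _ H], and delay [H] puts its skeleton
    within [rad (k.+1 + H)] of some [c]. The ball [P] of radius [rad k.+1] about [c] is removed from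
    [E]; by [rad_sep], everything chosen later is [a * rad k] away. Since [w P] is at most [V Q H]
    times the product of the [M j], the last inequality sums over the rounds. *)
Lemma branching (E : {set T}) : E \subset C -> exists (S : {set T}) (nu : T -> R),
  [/\ S \subset E, E != set0 -> S != set0, forall x, 0 <= nu x &
      forall x, x \notin S -> nu x = 0] /\
  [/\ forall (rho : R) n (u : nat -> T), 0 <= rho -> rho < a * rad k ->
        (forall i, (i <= n)%N -> u i \in S) ->
        (forall i, (i < n)%N -> d (u i) (u i.+1) <= rho) ->
        d (u 0%N) (u n) <= D * rho,
      forall m (A : {set T}), (k <= m <= K)%N ->
        (forall x y, x \in A -> y \in A -> d x y < a * rad m) ->
        \sum_(x in A) nu x <= root (W (m - H)%N) &
      w E <= (\sum_x nu x) * \prod_(j < H) M j].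
Proof.
have [n] := ubnP #|E|; elim: n E => // n IH E En EC.
have [->|E0] := eqVneq E set0.
  exists set0, (fun=> 0); split; split => //.
  - by move=> rho m u _ _ /(_ 0%N isT); rewrite inE.
  - by move=> m A _ _; rewrite big1.
  - by rewrite w0 big1// mul0r.
have [Q [Q0 QE kQ Qmax]] := exists_max H E0.
have [S1 [nu1 [g1 m1]]] := V_good kQ (leqnn H).
have [S1Q S10 nu10 supp1 ch1 [c loc1] cap1 top1] := g1.
pose P := [set y in E | d c y <= rad k.+1].
have PE : P \subset E by apply/subsetP => y; rewrite inE => /andP[].
have S1P : S1 \subset P.
  apply/subsetP => y yS; rewrite inE (subsetP QE) ?(subsetP S1Q)//=.
  by apply: le_trans (loc1 _ yS) _; apply: rad_decr; rewrite leq_addr.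
have P0 : P != set0.
  by have /set0Pn[y yS] := S10 Q0; apply/set0Pn; exists y; exact: (subsetP S1P).
have kP : inball k.+1 P.
  apply/existsP; exists c; apply/forallP => y; apply/implyP.
  by rewrite inE => /andP[].
have ltEP : (#|E :\: P| < n)%N.
  rewrite -ltnS (leq_trans _ En)// ltnS; apply: proper_card.
  rewrite properE subsetDl/=; apply/subsetPn.
  have /set0Pn[y yP] := P0; exists y; first exact: (subsetP PE).
  by rewrite inE yP.
have [S2 [nu2 [[S2E _ nu20 supp2] [ch2 cap2 w2]]]] :=
  IH _ ltEP (subset_trans (subsetDl _ _) EC).
have sep x y : x \in S1 -> y \in S2 -> a * rad k < d x y.
  move=> xS /(subsetP S2E); rewrite !inE => /andP[+ yE]; rewrite yE/= -ltNge => cy.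
  have := loc1 _ xS; have := dtri x c y; have := rad_sep k; lra.
exists (S1 :|: S2), (fun x => nu1 x + nu2 x); split; split.
- rewrite subUset (subset_trans S1P PE)/=.
  exact: subset_trans S2E (subsetDl _ _).
- move=> _; have /set0Pn[y yS] := S10 Q0.
  by apply/set0Pn; exists y; rewrite inE yS.
- by move=> x; rewrite addr_ge0.
- by move=> x; rewrite inE negb_or => /andP[? ?]; rewrite supp1// supp2// addr0.
- move=> rho m u rho0 rhok uS ustep.
  (* A chain with steps shorter than [a * rad k] cannot pass between [S1] and [S2]. *)
  have stay (S S' : {set T}) : (forall i, (i <= m)%N -> (u i \in S) || (u i \in S')) ->
      (forall x y, x \in S -> y \in S' -> a * rad k < d x y) ->
      u 0%N \in S -> forall i, (i <= m)%N -> u i \in S.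
    move=> uSS ss u0; elim=> [//|i IHi] im.
    have /orP[//|uS'] := uSS _ im.
    have := ss _ _ (IHi (ltnW im)) uS'; have := ustep _ im; lra.
  have uSS i : (i <= m)%N -> (u i \in S1) || (u i \in S2).
    by move=> im; have := uS i im; rewrite inE.
  have /orP[u0|u0] := uSS 0%N isT.
    by apply: ch1 => //; apply: (stay S1 S2).
  apply: ch2 => //; apply: (stay S2 S1) => //.
    by move=> i im; rewrite orbC uSS.
  by move=> x y xS yS; rewrite dC sep.
- move=> m A km Am.
  have le_rad : a * rad m <= a * rad k.
    have [a0|a0] := leP 0 a; first by rewrite ler_wpM2l// rad_decr//; case/andP: km.
    by have := mulr_ge0_le0 D_ge0 (ltW a0); rewrite leNgt (lt_le_trans _ aD).
  rewrite big_split/=.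
  (* By separation [A] meets at most one of [S1] and [S2]. If it meets [S1], the levels [m <= k + H]
     are handled by the total mass of [nu1]. *)
  have [/existsP[x /andP[xA xS1]]|] := boolP [exists x, (x \in A) && (x \in S1)].
    have -> : \sum_(x in A) nu2 x = 0.
      rewrite big1// => y yA; apply: supp2; apply/negP => yS2.
      have := sep _ _ xS1 yS2; have := Am _ _ xA yA; lra.
    rewrite addr0; have [Hm|mH] := leqP (k.+1 + H) m.
      by apply: cap1 => //; rewrite Hm; case/andP: km.
    apply: le_trans (le_mass _ nu10) _; apply: le_trans (top1 erefl) _.
    apply: root_le; first exact: W_ge0 kQ.
    by apply: W_decr; rewrite leq_subLR addnC ltnW.
  rewrite negb_exists => /forallP xA.
  rewrite big1 ?add0r; first exact: cap2.
  by move=> x xAx; apply: supp1; have := xA x; rewrite xAx.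
- have -> : E = P :|: (E :\: P) by rewrite -{1}(setID E P) (setIidPr PE).
  apply: le_trans (wU _ _) _; rewrite big_split/= mulrDl lerD//.
  apply: le_trans (V_prod kP) _; rewrite big_ord_recr/= mulrC m1.
  apply: ler_pM.
  + exact: V_ge0.
  + by apply: prodr_ge0 => j _; rewrite V_ge0// ltnW ?ltn_ord.
  + exact: Qmax.
  + apply: ler_prod => j _; have jH := ltnW (ltn_ord j).
    apply/andP; split; first exact: V_ge0.
    by apply: M_max => //; exact: subset_trans PE EC.
Qed.

End branching.

(* Writing V j for the largest mass realised with delay j, the H + 1
   inequalities V 0 >= \sum_c V H (c) and V j.+1 >= max_c V j (c), with c
   running over the children of C, multiply to \prod_j V j >= \sum_c w c >= w C.
   If V H would exceed the (H + 1)-th root of w C, all V j are set to that root. *)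
Lemma fragmentation n k : (k + n = K)%N -> forall C, inball k C ->
  exists v : nat -> R,
    (forall j, (j <= H)%N -> exists S nu, good k j C S nu /\ \sum_x nu x = v j) /\
    w C <= \prod_(j < H.+1) v j.
Proof.
elim: n k => [|n IH] k kn C kC.
all: have [->|C0] := eqVneq C set0; [exists (fun=> 0); split; last first;
  [by rewrite w0 prodr_ge0|] => j jH; exists set0, (fun=> 0);
  rewrite big1//; split => //; split => //;
  [by move=> rho m u _ /(_ 0%N isT); rewrite inE|
   by case/existsP: kC => c _; exists c => y; rewrite inE|
   by move=> m A _ _; rewrite big1|by rewrite big1] | ].
(* At the last level a single point carries the mass [root (w C)], for each of the [H.+1] delays. *)
- move: kn; rewrite addn0 => kK; subst k.
  exists (fun=> root (w C)); split; last by rewrite prodr_const card_ord rootK.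
  move=> j jH; have /set0Pn[x xC] := C0.
  exists [set x], (fun y => if y == x then root (w C) else 0).
  have Ex : \sum_y (if y == x then root (w C) else 0) = root (w C).
    by rewrite -big_mkcond big_pred1_eq.
  have rC : root (w C) <= root (W K) by apply: root_le => //; exact: wW.
  split => //; split.
  + by rewrite sub1set.
  + by move=> _; apply/set0Pn; exists x; rewrite inE.
  + by move=> y; case: ifP.
  + by move=> y; rewrite inE => /negbTE->.
  + move=> rho m u rho0 ux _; have := ux 0%N isT; have := ux m (leqnn m).
    by rewrite !inE => /eqP-> /eqP->; rewrite dxx mulr_ge0.
  + by exists x => y; rewrite inE => /eqP->; rewrite dxx.
  + move=> m A /andP[_ mK] _; apply: le_trans (le_mass _ _) _.
      by move=> y; case: ifP.
    rewrite Ex (le_trans rC)// root_le//; first exact: W_ge0 kC.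
    by apply: W_decr; rewrite leq_subLR (leq_trans mK)// leq_addl.
  + by rewrite Ex.
- have kn1 : (k.+1 + n = K)%N by rewrite addSn -addnS.
  have /choice[V HV] : forall Q, exists v : nat -> R, inball k.+1 Q ->
      (forall j, (j <= H)%N -> exists S nu, good k.+1 j Q S nu /\ \sum_x nu x = v j) /\
      w Q <= \prod_(j < H.+1) v j.
    move=> Q; have [kQ|] := boolP (inball k.+1 Q); last by exists (fun=> 0).
    by have [v hv] := IH _ kn1 Q kQ; exists v.
  have Vg Q j (kQ : inball k.+1 Q) := (HV Q kQ).1 j.
  have Vp Q (kQ : inball k.+1 Q) := (HV Q kQ).2.
  have /choice[Q HQ] := fun j => exists_max k V j C0.
  pose M j := V (Q j) j.
  have M_max P j : P != set0 -> P \subset C -> inball k.+1 P -> (j <= H)%N ->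
    V P j <= M j by move=> P0 PC kP _; have [_ _ _] := HQ j; apply.
  have up j : (j < H)%N -> (j.+1 = H -> M j <= root (W k)) ->
      exists S nu, good k j.+1 C S nu /\ \sum_x nu x = M j.
    move=> jH MW; have [Q0 QC kQ _] := HQ j.
    have [S [nu [g m]]] := Vg _ j kQ (ltnW jH).
    by exists S, nu; split => //; apply: good_up g QC Q0 _; rewrite m.
  have rC : root (w C) <= root (W k) by apply: root_le => //; exact: wW.
  (* If the best sub-ball at delay [H.-1] carries too much mass, it is scaled down to [root (w C)];
     [good_top] then holds at delay [H], and [good_reset] yields every delay. *)
  have [rM|Mr] := leP (root (w C)) (M H.-1).
    exists (fun=> root (w C)); split; last by rewrite prodr_const card_ord rootK.
    move=> j jH; have [Q0 QC kQ _] := HQ H.-1.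
    have [S [nu [g m]]] := Vg _ H.-1 kQ (leq_pred H).
    have [M0|M0] := eqVneq (M H.-1) 0.
      have r0 : root (w C) = 0 by apply/eqP; rewrite eq_le root_ge0 -M0 rM.
      exists S, nu; split; last by rewrite m r0.
      apply: good_reset => //; rewrite -(prednK H_gt0).
      by apply: good_up g QC Q0 _; rewrite m -/(M _) M0 => _; exact: root_ge0.
    pose l := root (w C) / M H.-1.
    have Mpos : 0 < M H.-1 by rewrite lt_neqAle eq_sym M0 (le_trans _ rM).
    have l01 : 0 <= l <= 1.
      by rewrite /l divr_ge0 ?(ltW Mpos)//= ler_pdivrMr// mul1r.
    have lM : \sum_x l * nu x = root (w C) by rewrite -mulr_sumr m mulfVK.
    exists S, (fun x => l * nu x); split => //.
    apply: good_reset => //; rewrite -(prednK H_gt0).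
    by apply: good_up (good_scale g l01) QC Q0 _; rewrite lM.
  (* Now [M H.-1 < root (w C) <= root (W k)], so [up] serves the delays from 1 to [H], and greedy
     branching serves delay 0. *)
  have [S [nu [[SC S0 nu0 supp] [ch cap wC]]]] :=
    @branching k V C M Vg Vp M_max C (subxx C).
  exists (fun j => if j is j'.+1 then M j' else \sum_x nu x); split; last first.
    by rewrite big_ord_recl.
  move=> [_|j jH]; last first.
    apply: up => // jH1; rewrite (le_trans (ltW (_ : M j < _)) rC)//.
    by move: Mr; rewrite -jH1.
  exists S, nu; split => //; split => //.
  (* Once [a * rad k <= rho], the diameter bound [2 * rad k <= D * (a * rad k)] suffices. *)
  + move=> rho m u rho0 uS ustep; have [rhok|rhok] := ltP rho (a * rad k).
      exact: ch.
    case/existsP: kC => c /forallP kC.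
    have cu i : (i <= m)%N -> d c (u i) <= rad k.
      by move=> im; have := kC (u i); rewrite (subsetP SC) ?uS.
    have := cu 0%N isT; have := cu m (leqnn m); have := dtri c (u 0%N) (u m).
    rewrite (dC (u 0%N) c) => h1 h2 h3.
    have h4 : d (u 0%N) (u m) <= 2 * rad k by lra.
    apply: le_trans h4 _; apply: le_trans (_ : D * (a * rad k) <= _).
      by rewrite mulrA ler_wpM2r.
    exact: ler_wpM2l.
  + case/existsP: kC => c /forallP kC; exists c => y yS.
    by rewrite addn0; have := kC y; rewrite (subsetP SC).
  + by move=> m A; rewrite addn0; exact: cap.
  + by move=> H0; move: H_gt0; rewrite -H0.
Qed.

(** Of [H.+1] factors with product at least [w setT], one is at least [root (w setT)]. Its delay is
    at most [H], whence the mass bounds from level [H] on. *)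
Lemma finite_skeleton : inball 0 setT -> exists (S : {set T}) (nu : T -> R),
  [/\ forall x, 0 <= nu x, forall x, x \notin S -> nu x = 0,
      chain_bounded d (fun x => x \in S) D,
      root (w setT) <= \sum_x nu x &
      forall m (A : {set T}), (H <= m <= K)%N ->
        (forall x y, x \in A -> y \in A -> d x y < a * rad m) ->
        \sum_(x in A) nu x <= root (W (m - H)%N)].
Proof.
move=> kT; have [v [vg wv]] := @fragmentation K 0 (add0n _) _ kT.
have [j jH rv] : exists2 j, (j <= H)%N & root (w setT) <= v j.
  apply/not_exists2P => nv.
  have lt_v j : (j <= H)%N -> v j < root (w setT).
    by move=> jH; case: (nv j) => // /negP; rewrite -ltNge.
  move: wv; apply/negP; rewrite -ltNge -[ltRHS]rootK//.
  rewrite -[in ltRHS](card_ord H.+1) -prodr_const; apply: ltr_prod.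
  + by apply/hasP; exists ord0; rewrite ?mem_index_enum.
  + move=> j _; rewrite (lt_v j (ltn_ord j)) andbT.
    have [S [nu [g <-]]] := vg j (ltn_ord j).
    by apply: sumr_ge0 => x _; exact: (good_ge0 g).
have [S [nu [g m]]] := vg j jH.
exists S, nu; split; [exact: good_ge0 g|exact: good_supp g|exact: good_chain g| |].
  by rewrite m.
move=> m' A /andP[Hm mK] Am; apply: (good_cap g) => //.
by rewrite add0n mK (leq_trans jH).
Qed.

End finite_fragmentation.

(** * Hausdorff content *)

Section hausdorff_content.
Context {R : realType} {X : metricType R}.
Implicit Types (A B : set X) (F : (set X)^nat) (s r : R).
Local Open Scope ereal_scope.

(** Diameters of covering sets are unrestricted, so bounded sets have finite content for [0 <= s],
    while positivity still controls the dimension. *)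
Definition hausdorff_content s A : \bar R :=
  ereal_inf [set \sum_(n <oo) hausdorff_gauge s (F n) |
    F in [set F : (set X)^nat | A `<=` \bigcup_n F n]].

Lemma hausdorff_gauge_ge0 s A : 0 <= hausdorff_gauge s A.
Proof. by rewrite /hausdorff_gauge; case: ifP => // _; exact: poweR_ge0. Qed.

Hint Resolve hausdorff_gauge_ge0 : core.

Lemma hausdorff_gauge0 s : hausdorff_gauge s (set0 : set X) = 0.
Proof. by rewrite /hausdorff_gauge eqxx. Qed.

Lemma le_ediam A x y : A x -> A y -> (mdist x y)%:E <= ediam A.
Proof. by move=> Ax Ay; apply: ereal_sup_ubound; exists (x, y). Qed.

Lemma ediam_ge0 A : A !=set0 -> 0 <= ediam A.
Proof.
by move=> [x Ax]; apply: le_trans (le_ediam Ax Ax); rewrite lee_fin mdist_ge0.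
Qed.

Lemma ediam_le A r : (forall x y, A x -> A y -> (mdist x y <= r)%R) ->
  ediam A <= r%:E.
Proof.
move=> Ar; apply: ge_ereal_sup => _ [[x y] [/= Ax Ay] <-].
by rewrite lee_fin Ar.
Qed.

Lemma hausdorff_gauge_le s A r : (0 <= s)%R -> (0 <= r)%R ->
  (forall x y, A x -> A y -> (mdist x y <= r)%R) ->
  hausdorff_gauge s A <= (r `^ s)%:E.
Proof.
move=> s0 r0 Ar; rewrite /hausdorff_gauge; case: ifPn => [_|/set0P A0].
  by rewrite lee_fin powR_ge0.
rewrite -poweR_EFin; apply: gt0_ler_poweR => //; last exact: ediam_le.
- by rewrite in_itv/= ediam_ge0//= leey.
- by rewrite in_itv/= lee_fin r0 leey.
Qed.

Lemma hausdorff_content_ge0 s A : 0 <= hausdorff_content s A.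
Proof.
by apply: le_ereal_inf_tmp => _ [F _ <-]; apply: nneseries_ge0 => n _ _.
Qed.

Lemma hausdorff_content_le_cover s A F : A `<=` \bigcup_n F n ->
  hausdorff_content s A <= \sum_(n <oo) hausdorff_gauge s (F n).
Proof. by move=> AF; apply: ereal_inf_lbound; exists F. Qed.

Lemma hausdorff_content_mono s A B : A `<=` B ->
  hausdorff_content s A <= hausdorff_content s B.
Proof.
move=> AB; apply: le_ereal_inf_tmp => _ [F BF <-].
by apply: hausdorff_content_le_cover; exact: subset_trans BF.
Qed.

Lemma hausdorff_content_le_gauge s A :
  hausdorff_content s A <= hausdorff_gauge s A.
Proof.
pose F n := if n is 0%N then A else set0.
apply: le_trans (@hausdorff_content_le_cover s A F _) _.
  by move=> x Ax; exists 0%N.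
rewrite (nneseries_split 0 1)//= big_nat1/= eseries0 ?adde0//.
by move=> [|n] // _ _; rewrite hausdorff_gauge0.
Qed.

Lemma hausdorff_content_set0 s : hausdorff_content s set0 = 0.
Proof.
apply/eqP; rewrite eq_le hausdorff_content_ge0 andbT.
by apply: le_trans (hausdorff_content_le_gauge _ _) _; rewrite hausdorff_gauge0.
Qed.

(** Merging two covers by parity gives the subadditivity of the content. *)
Lemma nneseries_interleave (f g : (\bar R)^nat) :
  (forall n, 0 <= f n) -> (forall n, 0 <= g n) ->
  \sum_(n <oo) (if odd n then g n./2 else f n./2) <=
  \sum_(n <oo) f n + \sum_(n <oo) g n.
Proof.
move=> f0 g0; rewrite -nneseriesD//.
pose u n := if odd n then g n./2 else f n./2; rewrite -/u.
have u0 n : 0 <= u n by rewrite /u; case: ifP.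
apply: lime_le; first by apply: is_cvg_nneseries => n _ _; exact: u0.
near=> n.
have double m : \sum_(0 <= i < m.*2) u i = \sum_(0 <= i < m) (f i + g i).
  elim: m => [|m IH]; first by rewrite !big_nil.
  rewrite [RHS]big_nat_recr//= -IH doubleS big_nat_recr//= big_nat_recr//=.
  by rewrite /u/= odd_double/= uphalf_double doubleK addeA.
apply: le_trans (_ : \sum_(0 <= i < n.*2) u i <= _).
  apply: lee_sum_nneg_natr; first by move=> i _ _; exact: u0.
  by rewrite -addnn leq_addr.
by rewrite double; apply: nneseries_lim_ge => i _ _; rewrite adde_ge0.
Unshelve. all: by end_near. Qed.

Lemma hausdorff_contentU s A B : hausdorff_content s (A `|` B) <=
  hausdorff_content s A + hausdorff_content s B.
Proof.
have [->|Aoo] := eqVneq (hausdorff_content s A) +oo.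
  by rewrite addye ?leey// gt_eqF// (lt_le_trans _ (hausdorff_content_ge0 _ _)).
have [->|Boo] := eqVneq (hausdorff_content s B) +oo.
  by rewrite addey ?leey// gt_eqF// (lt_le_trans _ (hausdorff_content_ge0 _ _)).
have fA : hausdorff_content s A \is a fin_num.
  by rewrite ge0_fin_numE ?hausdorff_content_ge0// ltey.
have fB : hausdorff_content s B \is a fin_num.
  by rewrite ge0_fin_numE ?hausdorff_content_ge0// ltey.
apply/lee_addgt0Pr => e e0; have e20 : (0 < e / 2)%R by rewrite divr_gt0.
have [_ [F AF <-] Fe] := lb_ereal_inf_adherent e20 fA.
have [_ [G BG <-] Ge] := lb_ereal_inf_adherent e20 fB.
pose U n := if odd n then G n./2 else F n./2.
apply: le_trans (@hausdorff_content_le_cover s _ U _) _.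
  move=> x [/AF[n _ Fx]|/BG[n _ Gx]].
    by exists n.*2 => //; rewrite /U odd_double doubleK.
  by exists n.*2.+1 => //; rewrite /U/= odd_double/= uphalf_double.
under eq_eseriesr do rewrite (fun_if (hausdorff_gauge s)).
apply: le_trans (_ : _ <= \sum_(n <oo) hausdorff_gauge s (F n) +
                          \sum_(n <oo) hausdorff_gauge s (G n)) _.
  exact: nneseries_interleave.
apply: le_trans (leeD (ltW Fe) (ltW Ge)) _.
by rewrite addeACA -EFinD -splitr.
Qed.

(** Some premeasure at a scale [delta] is at least some [c > 0]. A cover either has all diameters at
    most [delta] and costs at least [c], or contains a set of larger diameter, which alone costs at
    least [delta ^ s]. *)
Lemma hausdorff_content_gt0 s A : (0 <= s)%R -> s%:E < hausdorff_dim A ->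
  0 < hausdorff_content s A.
Proof.
move=> s0 sA.
have : hausdorff_measure s A <> 0.
  move=> m0; move: sA; apply/negP; rewrite -leNgt.
  by apply: ereal_inf_lbound; exists s.
have [[delta [d0 dpos]]|nd] :=
    pselect (exists delta, (0 < delta)%R /\ 0 < hausdorff_premeasure s delta A).
  move=> _; have [c [c0 cle]] : exists c, (0 < c)%R /\
      c%:E <= hausdorff_premeasure s delta A.
    move: dpos; case: hausdorff_premeasure => [c|_|//]; last by exists 1%R; rewrite leey.
    by rewrite lte_fin => c0; exists c.
  pose c' : R := Num.min c (delta `^ s)%R.
  have c'0 : (0 < c')%R by rewrite lt_min c0 powR_gt0.
  apply: lt_le_trans (_ : c'%:E <= _); first by rewrite lte_fin.
  apply: le_ereal_inf_tmp => _ [F AF <-].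
  have [Fd|] := pselect (forall n, ediam (F n) <= delta%:E).
    apply: le_trans (_ : c%:E <= _); first by rewrite lee_fin ge_min lexx.
    by apply: le_trans cle _; apply: ereal_inf_lbound; exists F.
  move=> /existsNP[n /negP]; rewrite -ltNge => Fn.
  apply: le_trans (_ : (delta `^ s)%:E <= _).
    by rewrite lee_fin ge_min lexx orbT.
  apply: le_trans (_ : hausdorff_gauge s (F n) <= _).
    have Fn0 : F n !=set0.
      apply/set0P/eqP => Fn0; move: Fn; rewrite Fn0 /ediam setX0 image_set0.
      by rewrite ereal_sup0.
    rewrite /hausdorff_gauge ifF; last by apply/negbTE/set0P.
    rewrite -poweR_EFin; apply: gt0_ler_poweR => //; last exact: ltW.
    + by rewrite in_itv/= lee_fin (ltW d0) leey.
    + by rewrite in_itv/= ediam_ge0//= leey.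
  apply: le_trans (@nneseries_lim_ge R _ xpredT 0%N n.+1 _) => //.
  by rewrite big_nat_recr//= leeDr// sume_ge0.
case; apply/eqP; rewrite eq_le; apply/andP; split.
  apply: ge_ereal_sup => _ [delta /= d0 <-].
  by rewrite leNgt; apply/negP => dpos; apply: nd; exists delta.
apply: le_trans (_ : hausdorff_premeasure s 1 A <= _); last first.
  by apply: ereal_sup_ubound; exists 1%R => //=.
apply: le_ereal_inf_tmp => _ [F _ <-].
by apply: nneseries_ge0.
Qed.

(** If the measure of exponent [t < s] vanished, cheap covers by sets of diameter at most 1 would be
    even cheaper for exponent [s]. *)
Lemma le_hausdorff_dim s A : (0 < s)%R -> 0 < hausdorff_content s A ->
  s%:E <= hausdorff_dim A.
Proof.
move=> s0 cA; apply: le_ereal_inf_tmp => _ [t [t0 tA] <-].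
rewrite lee_fin leNgt; apply/negP => ts.
have : hausdorff_premeasure t 1 A < hausdorff_content s A.
  apply: le_lt_trans cA; rewrite -tA.
  by apply: ereal_sup_ubound; exists 1%R => //=.
move=> /ereal_inf_lt[_ [F [AF F1] <-]]; apply/negP; rewrite -leNgt.
apply: le_trans (hausdorff_content_le_cover s AF) _.
apply: lee_nneseries => // n _; have := F1 n; rewrite /hausdorff_gauge.
case: ifPn => // /set0P F0; have := ediam_ge0 F0.
case: (ediam (F n)) => // r; rewrite !lee_fin => r0 r1.
have [->|rn0] := eqVneq r 0%R; first by rewrite powR0 ?gt_eqF// powR_ge0.
by rewrite ger_powR ?r1 ?andbT ?lt0r ?rn0// ltW.
Qed.

End hausdorff_content.

(** * Closed subsets of compact metric spaces *)

(** The near-covering form of compactness is applied to the filter of finite lists ordered by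
    inclusion. *)
Lemma compact_finite_cover (X : topologicalType) (U : X -> set X) :
  compact [set: X] -> (forall x, nbhs x (U x)) ->
  exists s : seq X, forall x, exists2 y, y \in s & U y x.
Proof.
move=> /compact_near_coveringP cX nU.
pose F := filter_from [set: seq X] (fun s => [set t : seq X | {subset s <= t}]).
have FF : Filter F.
  apply: filter_from_filter; first by exists [::].
  move=> s t _ _; exists (s ++ t) => // r str.
  by split => x xs; apply: str; rewrite mem_cat xs ?orbT.
pose P (s : seq X) x := exists2 y, y \in s & U y x.
have [x _|s _ sP] := cX _ F P FF.
  exists (U x, [set t : seq X | {subset [:: x] <= t}]).
    by split; [exact: nU | exists [:: x]].
  by move=> [z t] /= [Uz xt]; exists x => //; apply: xt; rewrite mem_head.
by exists s => x; apply: (sP s) => //= z.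
Qed.

Lemma exists_finite_net (R : realType) (X : metricType R) (A : set X) delta :
  compact [set: X] -> closed A -> 0 < delta ->
  exists n (y : 'I_n -> X), (forall i, A (y i)) /\
    forall x, A x -> exists i, mdist (y i) x < delta.
Proof.
move=> cX clA d0; pose U x := if `[< A x >] then ball x delta else ~` A.
(* Adding the open complement of [A] to the cover lets the net consist of points of [A]. *)
have [x|t ht] := @compact_finite_cover X U cX.
  rewrite /U; case: ifPn => [_|/asboolP Ax]; first exact: nbhsx_ballx.
  by apply: open_nbhs_nbhs; split => //; exact: closed_openC.
pose D := [seq x <- t | `[< A x >]].
exists (size D), (fun i => tnth (in_tuple D) i); split => [i|x Ax].
  by have := mem_tnth i (in_tuple D); rewrite mem_filter => /andP[/asboolP].
have [y yt] := ht x; rewrite /U; case: ifPn => [Ay|//]; rewrite ballEmdist/= => yx.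
have yD : y \in D by rewrite mem_filter Ay.
have yi : (index y D < size D)%N by rewrite index_mem.
by exists (Ordinal yi); rewrite (tnth_nth y)/= nth_index.
Qed.

(** * Skeletons at a finite scale *)

Section approximate_skeleton.
Variables (R : realType) (X : metricType R) (A : set X) (s a D tau R0 : R) (H : nat).
Hypothesis cX : compact [set: X].
Hypothesis clA : closed A.
Hypothesis s0 : 0 < s.
Hypothesis a0 : 0 < a.
Hypothesis aD : 2 <= D * a.
Hypothesis tau0 : 0 < tau.
Hypothesis tau1 : tau < 1.
Hypothesis H0 : (0 < H)%N.
Hypothesis tau_sep : tau ^+ H.+1 + a <= tau.
Hypothesis R00 : 0 < R0.
Hypothesis diamX : forall x y : X, mdist x y <= R0.

Let rad k := R0 * tau ^+ k.
Let sigma := s / H.+1%:R.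
(** Chosen so that [B * (a * rad m.+1) = 4 * rad (m - H)], which dominates the base of
    [W (m - H)]. *)
Let B := 4 / (a * tau ^+ H.+1).

Lemma hausdorff_content_fin_num : hausdorff_content s A \is a fin_num.
Proof.
rewrite ge0_fin_numE ?hausdorff_content_ge0//.
apply: le_lt_trans (hausdorff_content_le_gauge _ _) _.
by apply: le_lt_trans (@hausdorff_gauge_le _ _ _ _ R0 _ _ _) (ltry _) => //; exact: ltW.
Qed.

(** The measure of [finite_skeleton] on a net of mesh [rad K] yields a lower bound on the cost of
    every finite cover at scales above [a * rad K]. This form no longer mentions the measure and
    survives the limit in [K]. *)
Lemma approximate_skeleton K : exists SK : set X,
  [/\ SK `<=` A, chain_bounded (@mdist R X) SK D &
  forall N (O : nat -> set X) (rho : nat -> R),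
    (forall i, (i < N)%N -> a * rad K <= rho i < a * rad H) ->
    (forall i x y, (i < N)%N -> O i x -> O i y -> mdist x y <= rho i) ->
    (forall x, SK x -> exists2 i, (i < N)%N & O i x) ->
    (fine (hausdorff_content s A)) `^ H.+1%:R^-1 <=
      \sum_(i < N) (B * rho i) `^ sigma].
Proof.
have [-> | /set0P[x0 Ax0]] := eqVneq A set0.
  exists set0; split=> [//|rho n u _ /(_ 0%N isT)//|N O rho _ _ _].
  rewrite hausdorff_content_set0 powR0 ?invr_eq0 ?pnatr_eq0//.
  by apply: sumr_ge0 => i _; exact: powR_ge0.
have rad_gt0 k : 0 < rad k by rewrite mulr_gt0 ?exprn_gt0.
have rad_decr k l : (k <= l)%N -> rad l <= rad k.
  move=> kl; rewrite ler_pM2l//; apply: ler_wiXn2l => //; exact: ltW.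
have [n [y [Ay netA]]] := exists_finite_net cX clA (rad_gt0 K).
pose d (i j : 'I_n) := mdist (y i) (y j).
(* Sets of net points are weighed by the content of the part of [A] near them; the full net then
   weighs as much as [A]. *)
pose fat (C : {set 'I_n}) :=
  \bigcup_(i in [set` C]) [set x : X | A x /\ mdist (y i) x < rad K].
have fatU P C : fat (P :|: C)%SET = fat P `|` fat C.
  apply/seteqP; split => x.
    by move=> [i /=]; rewrite finset.in_setU => /orP[] iA ix; [left|right]; exists i.
  by move=> [[i /= iA ix]|[i /= iA ix]]; exists i => //=; rewrite finset.in_setU iA ?orbT.
pose w C := fine (hausdorff_content s (fat C)).
have fin_fat C : hausdorff_content s (fat C) \is a fin_num.
  rewrite ge0_fin_numE ?hausdorff_content_ge0//.
  have fatA : fat C `<=` A by move=> x [i _ []].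
  apply: le_lt_trans (hausdorff_content_mono _ fatA) _.
  by rewrite -ge0_fin_numE ?hausdorff_content_ge0// hausdorff_content_fin_num.
have w_ge0 C : 0 <= w C by rewrite fine_ge0// hausdorff_content_ge0.
have w0 : w finset.set0 = 0.
  rewrite /w (_ : fat _ = set0) ?hausdorff_content_set0//.
  by apply/seteqP; split => // x [i /=]; rewrite finset.inE.
have wU P C : w (P :|: C)%SET <= w P + w C.
  by rewrite /w -fineD// fine_le ?fin_numD ?fin_fat// fatU hausdorff_contentU.
have wT : w finset.setT = fine (hausdorff_content s A).
  rewrite /w (_ : fat _ = A)//; apply/seteqP; split => [x [i _ []]//|x Ax].
  by have [i ix] := netA x Ax; exists i => //=; rewrite finset.in_setT.
(* A set of radius [rad k] has diameter at most [2 * rad k], and fattening adds [rad K] at either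
   end. *)
pose W k := (2 * rad k + 2 * rad K) `^ s.
have W_decr k l : (k <= l)%N -> W l <= W k.
  move=> kl; apply: ge0_ler_powR; rewrite ?nnegrE ?(ltW s0)//.
  - by rewrite addr_ge0// mulr_ge0// ltW.
  - by rewrite addr_ge0// mulr_ge0// ltW.
  - by rewrite lerD2r ler_pM2l// rad_decr.
have wW k C : inball d rad k C -> w C <= W k.
  move=> /existsP[c /forallP kC]; rewrite -lee_fin /w fineK//.
  apply: le_trans (hausdorff_content_le_gauge _ _) _.
  apply: hausdorff_gauge_le; first exact: ltW.
    by rewrite addr_ge0// mulr_ge0// ltW.
  move=> x z [i /= iC [_ ix]] [j /= jC [_ jz]].
  have := kC i; have := kC j; rewrite iC jC /d/= => cj ci.
  have := metric_triangle x (y i) z; have := metric_triangle (y i) (y c) z.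
  have := metric_triangle (y c) (y j) z.
  rewrite (metric_sym x (y i)) (metric_sym (y i) (y c)); lra.
have D_ge0 : 0 <= D.
  have : 0 < D * a by apply: lt_le_trans aD.
  by rewrite pmulr_lgt0// => /ltW.
have rad_sep k : rad (k.+1 + H)%N + a * rad k <= rad k.+1.
  have -> : rad (k.+1 + H)%N + a * rad k = rad k * (tau ^+ H.+1 + a).
    by rewrite /rad addSnnS exprD; ring.
  have -> : rad k.+1 = rad k * tau by rewrite /rad exprSr mulrA.
  by rewrite ler_pM2l.
have kT : inball d rad 0 finset.setT.
  have [c _] := netA x0 Ax0.
  apply/existsP; exists c; apply/forallP => i; apply/implyP => _.
  by rewrite /d /rad expr0 mulr1.
have [S [nu [nu0 supp ch mass cap]]] := @finite_skeleton R 'I_n d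
  (fun i => mdistxx (y i)) (fun i j => metric_sym (y i) (y j))
  (fun j i k => metric_triangle (y i) (y j) (y k)) w rad W a D H K
  w0 w_ge0 wU H0 (fun k => ltW (rad_gt0 k)) rad_decr rad_sep aD D_ge0 W_decr wW kT.
exists (y @` [set` S]); split; first by move=> _ [i _ <-].
  move=> rho m u rho0 uS ustep.
  have [i0 _ yi0] := uS 0%N isT.
  have /choice[v hv] : forall i, exists j : 'I_n, (i <= m)%N -> j \in S /\ y j = u i.
    move=> i; have [im|_] := leqP i m; last by exists i0.
    by have [j jS yj] := uS i im; exists j.
  have yv i im := (hv i im).2.
  rewrite -(yv 0%N)// -(yv m)//; apply: (ch rho m v) => // i im.
    by have [] := hv i im.
  by rewrite /d !yv ?(ltnW im)//; exact: ustep.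
move=> N O rho rho_lim Orho SO; rewrite wT in mass; apply: le_trans mass _.
pose P (i : 'I_N) := [set j : 'I_n | (j \in S) && `[< O i (y j) >]]%SET.
apply: le_trans (_ : \sum_(i < N) \sum_(j in P i) nu j <= _).
  under [leRHS]eq_bigr do rewrite big_mkcond/=.
  rewrite exchange_big/=; apply: ler_sum => j _.
  have ge0 (i : 'I_N) : 0 <= (if j \in P i then nu j else 0) by case: ifP.
  have [jS|jS] := boolP (j \in S); last first.
    by rewrite (supp j jS); apply: sumr_ge0 => i _; case: ifP.
  have [|i iN Oi] := SO (y j); first by exists j.
  rewrite (bigD1 (Ordinal iN))//= finset.inE jS/=; move/asboolP: (Oi) => ->.
  by rewrite lerDl sumr_ge0.
apply: ler_sum => i _; have iN := ltn_ord i.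
have /andP[Krho rhoH] := rho_lim i iN.
have rho_gt0 : 0 < rho i by apply: lt_le_trans Krho; rewrite mulr_gt0.
(* The level of [rho i]; its two bounds place [m] in the range where [cap] applies. *)
have [m /andP[Hm mK] /andP[mrho rhom]] : exists2 m, (H <= m <= K)%N &
    a * rad m.+1 <= rho i < a * rad m.
  have ex : exists m, a * rad m.+1 <= rho i.
    by exists K; apply: le_trans Krho; rewrite ler_pM2l// rad_decr.
  have mrho := ex_minnP ex; case: mrho => m mrho mmin; exists m; last first.
    rewrite mrho/=; case: m mrho mmin => [_ _|m mrho mmin].
      by apply: lt_le_trans rhoH _; rewrite ler_pM2l// rad_decr.
    by rewrite ltNge; apply/negP => /mmin; rewrite ltnn.
  apply/andP; split.
    rewrite leqNgt; apply/negP => mH; move: rhoH; apply/negP; rewrite -leNgt.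
    by apply: le_trans mrho; rewrite ler_pM2l// rad_decr.
  have [K0|K0] := posnP K.
    by apply: mmin; rewrite K0; apply: le_trans Krho; rewrite K0 ler_pM2l// rad_decr.
  apply: leq_trans (leq_pred K); apply: mmin; rewrite prednK//.
apply: le_trans (cap m (P i) _ _) _; first by rewrite Hm.
  move=> j l; rewrite !finset.inE => /andP[_ /asboolP Oj] /andP[_ /asboolP Ol].
  by apply: le_lt_trans rhom; exact: (Orho i).
rewrite -powRrM /sigma; apply: ge0_ler_powR; rewrite ?nnegrE.
- by rewrite mulr_ge0 ?invr_ge0 ?ler0n// ltW.
- by apply: addr_ge0; apply: mulr_ge0 => //; exact: ltW.
- by rewrite mulr_ge0 ?(ltW rho_gt0)// divr_ge0// mulr_ge0 ?(ltW a0)// exprn_ge0// ltW.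
apply: le_trans (_ : 4 * rad (m - H)%N <= _).
  have : rad K <= rad (m - H)%N.
    by apply: rad_decr; rewrite leq_subLR (leq_trans mK)// leq_addl.
  lra.
apply: le_trans (_ : B * (a * rad m.+1) <= _); last first.
  by rewrite ler_pM2l// divr_gt0// mulr_gt0// exprn_gt0.
rewrite /B /rad -(subnK Hm) addnK -addnS exprD.
rewrite le_eqVlt; apply/orP; left; apply/eqP.
by field; rewrite ?gt_eqF ?exprn_gt0.
Qed.

End approximate_skeleton.

(** * Passage to the limit *)

(** The strict inequality leaves room to enlarge [A] by half of the gap between [r] and its
    diameter. Open covers are what compactness can reduce to finite ones. *)
Lemma open_fattening (R : realType) (X : metricType R) (s r : R) (A : set X) :
  0 < s -> 0 < r -> (hausdorff_gauge s A < (r `^ s)%:E)%E ->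
  exists O : set X, [/\ open O, A `<=` O & forall x y, O x -> O y -> mdist x y <= r].
Proof.
move=> s0 r0; have [->|/set0P A0] := eqVneq A set0.
  by move=> _; exists set0; split => //; exact: open0.
rewrite /hausdorff_gauge ifF; last exact/negbTE/set0P.
have := ediam_ge0 A0; have := @le_ediam R X A.
case: (ediam A) => [d|_ _|//]; last by rewrite poweRyr ?gt_eqF.
move=> dA; rewrite lee_fin poweR_EFin lte_fin => d0 dr.
have {}dr : d < r.
  rewrite ltNge; apply/negP => rd; move: dr; apply/negP; rewrite -leNgt.
  by apply: ge0_ler_powR; rewrite ?nnegrE// ltW.
pose e := (r - d) / 2; have e0 : 0 < e by rewrite divr_gt0// subr_gt0.
exists (\bigcup_(y in A) (ball y e)^°); split.
- by apply: bigcup_open => y _; exact: open_interior.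
- by move=> x Ax; exists x => //; exact: nbhsx_ballx.
- move=> x y [u Au /interior_subset ux] [v Av /interior_subset vy].
  move: ux vy; rewrite !ballEmdist/= => ux vy.
  have := dA _ _ Au Av; rewrite lee_fin => uv.
  have := metric_triangle x u y; have := metric_triangle u v y.
  rewrite (metric_sym x u); move: ux vy uv; rewrite /e; lra.
Qed.

(* The limit set of SK along an ultrafilter finer than eventuality. *)
Lemma exists_ultralimit (R : realType) (X : metricType R) (SK : nat -> set X) :
  compact [set: X] -> exists S : set X,
  [/\ closed S,
      forall (O : set X) (K0 : nat), open O -> S `<=` O ->
        exists2 K, (K0 <= K)%N & SK K `<=` O &
      forall m (u : nat -> X) e, 0 < e -> (forall i, (i <= m)%N -> S (u i)) ->
        exists K, forall i, (i <= m)%N -> exists2 z, SK K z & mdist (u i) z < e].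
Proof.
move=> cX; have [G [GU ooG]] := @ultraFilterLemma nat \oo _.
pose near_SK x e := [set K | exists2 z, SK K z & mdist x z < e].
exists [set x | forall e, 0 < e -> G (near_SK x e)]; split.
- move=> x clx e e0 /=; have e20 : 0 < e / 2 by rewrite divr_gt0.
  have [y [Sy]] := clx _ (nbhsx_ballx x _ e20); rewrite ballEmdist/= => xy.
  apply: filterS (Sy _ e20) => K [z Kz yz]; exists z => //.
  by have := metric_triangle x y z; lra.
- move=> O K0 oO SO.
  have GK0 : G [set K | (K0 <= K)%N] by apply: ooG; exact: nbhs_infty_ge.
  have [GO|GnO] := in_ultra_setVsetC [set K | SK K `<=` O] GU.
    by have [K [? ?]] := filter_ex (filterI GK0 GO); exists K.
  have [K1 /= nK1] := filter_ex GnO.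
  have [x0 _] : exists x : X, True.
    by apply: contrapT => nX; apply: nK1 => x; exfalso; apply: nX; exists x.
  (* If [SK K] leaves [O] for [G]-almost all [K], pick [z K] in it outside [O]. A cluster point [p]
     of [z] along [G] lies in the limit set, hence in the open set [O], a contradiction. *)
  have /choice[z hz] : forall K, exists z, ~ (SK K `<=` O) -> SK K z /\ ~ O z.
    move=> K; have [?|nK] := pselect (SK K `<=` O); first by exists x0.
    by have /existsNP[z /not_implyP ?] := nK; exists z.
  have [|p [_ clp]] := cX (z @ G) _; first exact: filterT.
  have Op : O p.
    apply: SO => e e0 /=.
    have [Ge|Gne] := in_ultra_setVsetC [set K | mdist p (z K) < e] GU.
      apply: filterS (filterI Ge GnO) => K [pz /hz[? _]].
      by exists (z K).
    have far : (z @ G) (~` [set y | mdist p y < e]) by [].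
    have [y []] := clp _ _ far (nbhsx_ballx p _ e0).
    by rewrite ballEmdist.
  have out : (z @ G) (~` O).
    by have : G (z @^-1` (~` O)) by apply: filterS GnO => K /hz[_].
  have [y [nOy Oy]] := clp _ _ out (open_nbhs_nbhs (conj oO Op)).
  by exfalso; exact: nOy.
- move=> m u e e0 uS.
  have : forall k, (k <= m)%N -> G [set K | forall i, (i <= k)%N ->
      exists2 z, SK K z & mdist (u i) z < e].
    elim=> [|k IH] km.
      by apply: filterS (uS 0%N isT _ e0) => K hK i; rewrite leqn0 => /eqP->.
    apply: filterS (filterI (IH (ltnW km)) (uS _ km _ e0)) => K [hK hk] i.
    by rewrite leq_eqVlt => /predU1P[->//|]; exact: hK.
  by move=> /(_ m (leqnn m))/filter_ex[K hK]; exists K.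
Qed.

Lemma exists_expr_le (R : realType) (tau r : R) : 0 < tau -> tau < 1 -> 0 < r ->
  exists K0, forall K, (K0 <= K)%N -> tau ^+ K <= r.
Proof.
move=> t0 t1 r0.
have taun1 : `|tau| < 1 by rewrite gtr0_norm.
have /cvgrPdist_le/(_ _ r0)[K0 _ hK] := cvg_expr taun1.
by exists K0 => K /hK/=; rewrite sub0r normrN gtr0_norm ?exprn_gt0.
Qed.

Lemma compact_mdist_bounded (R : realType) (X : metricType R) :
  compact [set: X] -> exists2 R0 : R, 0 < R0 & forall x y : X, mdist x y <= R0.
Proof.
move=> cX; have [[x0 _]|noX] := pselect (exists x : X, True); last first.
  by exists 1 => // x; exfalso; apply: noX; exists x.
have [x|t ht] := @compact_finite_cover X (fun x => ball x 1) cX.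
  exact: nbhsx_ballx.
pose M := \sum_(z <- t) mdist x0 z.
have M0 : 0 <= M by apply: sumr_ge0 => z _; exact: mdist_ge0.
have x0M x : mdist x0 x <= M + 1.
  have [z zt] := ht x; rewrite ballEmdist/= => zx.
  have : mdist x0 z <= M.
    rewrite /M (big_rem z)//= lerDl sumr_ge0// => y _; exact: mdist_ge0.
  have := metric_triangle x0 z x; lra.
exists (2 * (M + 1)) => [|x y]; first by lra.
have := metric_triangle x x0 y; rewrite (metric_sym x x0).
have := x0M x; have := x0M y; lra.
Qed.

Lemma sum_half_powers (R : realType) N :
  \sum_(i < N) (2 : R) ^- i.+1 = 1 - 2 ^- N.
Proof.
elim: N => [|N IH]; first by rewrite big_ord0 expr0 invr1 subrr.
rewrite big_ord_recr/= IH exprS invfM; lra.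
Qed.

Section skeleton.
Variables (R : realType) (X : metricType R) (A : set X) (s a D tau : R) (H : nat).
Hypothesis cX : compact [set: X].
Hypothesis clA : closed A.
Hypothesis s0 : 0 < s.
Hypothesis a0 : 0 < a.
Hypothesis aD : 2 <= D * a.
Hypothesis tau0 : 0 < tau.
Hypothesis tau1 : tau < 1.
Hypothesis H0 : (0 < H)%N.
Hypothesis tau_sep : tau ^+ H.+1 + a <= tau.

(** The set [S] is an ultralimit of approximate skeletons. A cover of [S] cheaper than [c2] could be
    enlarged to finitely many open sets, which would cover some [SK K] with [K] large, against the
    lower bound of [approximate_skeleton]. *)
Lemma exists_skeleton : (0 < hausdorff_content s A)%E ->
  exists S : set X, [/\ closed S, S `<=` A, chain_bounded (@mdist R X) S D &
    (0 < hausdorff_content (s / H.+1%:R) S)%E].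
Proof.
move=> content_gt0; have [R0 R00 diamX] := compact_mdist_bounded cX.
pose sigma := s / H.+1%:R.
have sigma0 : 0 < sigma by rewrite divr_gt0// ltr0n.
pose B := 4 / (a * tau ^+ H.+1).
have B0 : 0 < B by rewrite divr_gt0// mulr_gt0// exprn_gt0.
pose rad k := R0 * tau ^+ k.
have rad_gt0 k : 0 < rad k by rewrite mulr_gt0 ?exprn_gt0.
pose c1 := (fine (hausdorff_content s A)) `^ H.+1%:R^-1.
have c10 : 0 < c1.
  apply: powR_gt0; apply: fine_gt0; rewrite content_gt0/= -ge0_fin_numE ?ltW//.
  exact: hausdorff_content_fin_num diamX.
have D_ge0 : 0 <= D.
  have : 0 < D * a by apply: lt_le_trans aD.
  by rewrite pmulr_lgt0// => /ltW.
have /choice[SK hSK] :=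
  approximate_skeleton cX clA s0 a0 aD tau0 tau1 H0 tau_sep R00 diamX.
have [S [clS SO Su]] := exists_ultralimit SK cX.
exists S; split => //.
- move=> x Sx; apply: clA => P /nbhs_ballP[e e0 eP].
  have [K /(_ 0%N isT)[z Kz xz]] := Su 0%N (fun=> x) e e0 (fun _ _ => Sx).
  have [SKA _ _] := hSK K; exists z; split; first exact: SKA.
  by apply: eP; rewrite ballEmdist.
- move=> rho m u rho0 uS ustep; apply/ler_addgt0Pr => e e0.
  (* Moving the chain by [eta] lengthens steps by [2 * eta], which costs [2 * D * eta], and shifts
     the ends by [2 * eta] in all. *)
  pose eta := e / (2 * D + 2).
  have D20 : 0 < 2 * D + 2 by lra.
  have eta0 : 0 < eta by rewrite divr_gt0.
  have etaE : 2 * D * eta + 2 * eta = e by rewrite -mulrDl mulrC divfK ?gt_eqF.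
  have [K hK] := Su m u eta eta0 uS.
  have /choice[v hv] : forall i, exists z, (i <= m)%N ->
      SK K z /\ mdist (u i) z < eta.
    move=> i; have [/hK[z Kz uz]|_] := leqP i m; first by exists z.
    by exists (u 0%N).
  have vch : mdist (v 0%N) (v m) <= D * (rho + 2 * eta).
    have [_ chK _] := hSK K; apply: chK => [|i im|i im]; first by lra.
      by have [] := hv i im.
    have [_ ui] := hv i (ltnW im); have [_ ui1] := hv i.+1 im.
    have := ustep i im; have := metric_triangle (v i) (u i) (v i.+1).
    have := metric_triangle (u i) (u i.+1) (v i.+1).
    rewrite (metric_sym (v i) (u i)); lra.
  have [_ u0] := hv 0%N isT; have [_ um] := hv m (leqnn m).
  have := metric_triangle (u 0%N) (v 0%N) (u m).
  have := metric_triangle (v 0%N) (v m) (u m).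
  rewrite (metric_sym (v m) (u m)); move: vch; rewrite mulrDr mulrCA => h1 h2 h3.
  lra.
(* The enlarged cover costs at most [2 * c2]. The first bound keeps this below [c1] after
   multiplication by [B ^ sigma], the second forces every [rho i] below [a * rad H]. *)
pose c2 := Num.min (c1 / (3 * B `^ sigma)) ((a * rad H) `^ sigma / 3).
have Bs0 : 0 < B `^ sigma by exact: powR_gt0.
have aH0 : 0 < a * rad H by rewrite mulr_gt0.
have c20 : 0 < c2.
  rewrite lt_min; apply/andP; split; apply: divr_gt0 => //.
    exact: mulr_gt0.
  exact: powR_gt0.
have c2B : 2 * c2 * B `^ sigma < c1.
  have : c2 <= c1 / (3 * B `^ sigma) by rewrite ge_min lexx.
  rewrite ler_pdivlMr ?mulr_gt0//; lra.
have c2H : 2 * c2 < (a * rad H) `^ sigma.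
  have : c2 <= (a * rad H) `^ sigma / 3 by rewrite ge_min lexx orbT.
  have : 0 < (a * rad H) `^ sigma by exact: powR_gt0.
  lra.
apply: lt_le_trans (_ : (c2%:E <= _)%E); first by rewrite lte_fin.
apply: le_ereal_inf_tmp => _ [F SF <-]; rewrite leNgt; apply/negP => Fc2.
have gauge_sum N : (\sum_(i < N) hausdorff_gauge sigma (F i) <= c2%:E)%E.
  rewrite -(big_mkord xpredT (fun i => hausdorff_gauge sigma (F i))).
  apply: le_trans (ltW Fc2); apply: nneseries_lim_ge => i _ _.
  exact: hausdorff_gauge_ge0.
have gauge_fin i : hausdorff_gauge sigma (F i) \is a fin_num.
  rewrite ge0_fin_numE ?hausdorff_gauge_ge0//; apply: le_lt_trans (ltry c2).
  apply: le_trans (gauge_sum i.+1).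
  rewrite big_ord_recr/= leeDr// sume_ge0// => j _.
  exact: hausdorff_gauge_ge0.
pose g i := fine (hausdorff_gauge sigma (F i)).
have g0 i : 0 <= g i by rewrite fine_ge0// hausdorff_gauge_ge0.
have g_sum N : \sum_(i < N) g i <= c2.
  rewrite -lee_fin -sumEFin; apply: le_trans (gauge_sum N).
  by apply: lee_sum => i _; rewrite fineK.
(* The geometric surplus, at most [c2] in total, makes every [q i] positive and strictly larger than
   the gauge. *)
pose q i := g i + c2 * 2 ^- i.+1.
have q0 i : 0 < q i.
  by rewrite ltr_wpDl// mulr_gt0// invr_gt0 exprn_gt0.
have q_sum N : \sum_(i < N) q i <= 2 * c2.
  rewrite big_split/= -mulr_sumr sum_half_powers.
  have : 0 < c2 * 2 ^- N by rewrite mulr_gt0// invr_gt0 exprn_gt0.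
  have := g_sum N; lra.
pose rho i := q i `^ sigma^-1.
have rho0 i : 0 < rho i by exact: powR_gt0.
have rhoE i : rho i `^ sigma = q i.
  by rewrite -powRrM mulVf ?gt_eqF// powRr1// ltW.
have /choice[ O hO] : forall i, exists O : set X, [/\ open O, F i `<=` O &
    forall x y, O x -> O y -> mdist x y <= rho i].
  move=> i; apply: (@open_fattening _ _ sigma) => //.
  rewrite rhoE -(fineK (gauge_fin i)) lte_fin ltrDl.
  by rewrite mulr_gt0// invr_gt0 exprn_gt0.
have [N SN] : exists N, S `<=` \bigcup_(i in [set i | (i < N)%N]) O i.
  have /choice[idx hidx] : forall x, exists i, S x -> O i x.
    move=> x; have [/SF[i _ Fx]|] := pselect (S x); last by exists 0%N.
    by exists i => _; have [_ FO _] := hO i; exact: FO.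
  pose U x := if `[< S x >] then O (idx x) else ~` S.
  have [x|t ht] := @compact_finite_cover X U cX.
    apply: open_nbhs_nbhs; rewrite /U; case: ifPn => [/asboolP Sx|/asboolP Sx].
      by split; [have [] := hO (idx x)|exact: hidx].
    by split => //; exact: closed_openC.
  exists (\max_(y <- t) idx y).+1 => x Sx; have [y yt] := ht x.
  rewrite /U; case: ifPn => // _ Ox; exists (idx y) => //=.
  by rewrite ltnS; apply: leq_bigmax_seq.
have oN : open (\bigcup_(i in [set i | (i < N)%N]) O i).
  by apply: bigcup_open => i _; have [] := hO i.
have [K0 hK0] : exists K0, forall K i, (K0 <= K)%N -> (i < N)%N ->
    a * rad K <= rho i.
  have [|K0 hK0] := @exists_expr_le R tau
      ((\big[Num.min/1]_(i < N) rho i) / (a * R0)) tau0 tau1.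
    by rewrite divr_gt0 ?mulr_gt0//; apply/bigmin_gtP.
  exists K0 => K i /hK0 + iN; rewrite ler_pdivlMr ?mulr_gt0// mulrC -mulrA.
  by move=> /le_trans; apply; apply: (bigmin_le_cond _ (j := Ordinal iN)).
have [K K0K SKO] := SO _ K0 oN SN.
have : c1 <= \sum_(i < N) (B * rho i) `^ sigma.
  have [_ _ covK] := hSK K; apply: (covK N O rho).
  - move=> i iN; rewrite (hK0 K i)//=; rewrite ltNge; apply/negP => Hrho.
    have Hq : (a * rad H) `^ sigma <= q i.
      by rewrite -rhoE; apply: ge0_ler_powR => //; rewrite ?nnegrE; exact: ltW.
    have qi : q i <= 2 * c2.
      apply: le_trans (q_sum i.+1); rewrite big_ord_recr/= lerDr.
      by apply: sumr_ge0 => j _; exact: ltW.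
    by have := le_lt_trans (le_trans Hq qi) c2H; rewrite ltxx.
  - by move=> i x y iN Ox Oy; have [_ _] := hO i; apply.
  - by move=> x /SKO[i /= iN Ox]; exists i.
apply/negP; rewrite -ltNge; apply: le_lt_trans c2B.
under eq_bigr do rewrite powRM ?(ltW B0) ?(ltW (rho0 _))// rhoE.
by rewrite -mulr_sumr mulrC ler_pM2r.
Qed.

End skeleton.

(** * Infinite dimension *)

Section infinite_dimension.
Variables (R : realType) (X : metricType R).
Implicit Types (A : set X) (x : X).

(** Sets in a cover of total gauge below 1 have diameter at most 1, so a larger exponent lowers
    their gauge. *)
Lemma hausdorff_content_eq0 (s t : R) A : 0 < s -> s <= t ->
  hausdorff_content s A = 0%E -> hausdorff_content t A = 0%E.
Proof.
move=> s0 st sA; apply/eqP; rewrite eq_le hausdorff_content_ge0 andbT.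
apply/lee_addgt0Pr => e e0; rewrite add0e.
pose e' := Num.min e 1; have e'0 : (0 < e'%:E)%E by rewrite lte_fin lt_min e0/=.
have : (hausdorff_content s A < e'%:E)%E by rewrite sA.
move=> /ereal_inf_lt[_ [F AF <-] Fe].
apply: le_trans (hausdorff_content_le_cover t AF) _.
apply: le_trans (_ : (e'%:E <= _)%E); last by rewrite lee_fin ge_min lexx.
apply: le_trans (ltW Fe); apply: lee_nneseries => [n _ _|n _].
  exact: hausdorff_gauge_ge0.
have : (hausdorff_gauge s (F n) <= 1)%E.
  apply: le_trans (_ : (\sum_(k <oo) hausdorff_gauge s (F k) <= _)%E); last first.
    by apply: le_trans (ltW Fe) _; rewrite lee_fin ge_min lexx orbT.
  apply: le_trans (@nneseries_lim_ge R _ xpredT 0%N n.+1 _) => [|k _ _]; last first.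
    exact: hausdorff_gauge_ge0.
  rewrite big_nat_recr//= leeDr// sume_ge0// => k _; exact: hausdorff_gauge_ge0.
rewrite /hausdorff_gauge; case: ifPn => // /set0P F0; have := ediam_ge0 F0.
case: (ediam (F n)) => [r||//]; last by rewrite poweRyr ?gt_eqF// leye_eq.
rewrite lee_fin !poweR_EFin !lee_fin => r0 rs.
have r1 : r <= 1.
  rewrite leNgt; apply/negP => r1; move: rs; apply/negP; rewrite -ltNge.
  have := gt0_ltr_powR s0 _ _ r1; rewrite powR1; apply; rewrite nnegrE//.
have [->|rn0] := eqVneq r 0.
  by rewrite powR0 ?powR_ge0// gt_eqF// (lt_le_trans s0).
by rewrite ger_powR// r1 andbT lt0r rn0.
Qed.

Hypothesis cX : compact [set: X].

(** Otherwise each point has a ball that is null for some exponent; finitely many such balls cover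
    [X], which would be null for the largest of these exponents. *)
Lemma exists_everywhere_thick :
  (forall n : nat, 0 < hausdorff_content n.+1%:R [set: X])%E ->
  exists x0, forall (n : nat) r, 0 < r ->
    (0 < hausdorff_content n.+1%:R (ball x0 r))%E.
Proof.
move=> Xinf; apply: contrapT => nx0.
have /choice[f hf] : forall x, exists nr : nat * R, 0 < nr.2 /\
    hausdorff_content nr.1.+1%:R (ball x nr.2) = 0%E.
  move=> x; apply: contrapT => nx; apply: nx0; exists x => n r r0.
  rewrite lt0e hausdorff_content_ge0 andbT; apply/eqP => c0.
  by apply: nx; exists (n, r).
have [x|t ht] := @compact_finite_cover X (fun x => ball x (f x).2) cX.
  by apply: nbhsx_ballx; have [] := hf x.
pose N := \max_(y <- t) (f y).1.
have null (t' : seq X) : {subset t' <= t} ->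
    hausdorff_content N.+1%:R [set x | exists2 y, y \in t' & ball y (f y).2 x] = 0%E.
  elim: t' => [_|y t' IH ty].
    rewrite (_ : mkset _ = set0) ?hausdorff_content_set0//.
    by apply/seteqP; split => // x [].
  apply/eqP; rewrite eq_le hausdorff_content_ge0 andbT.
  apply: le_trans (_ : (hausdorff_content N.+1%:R (ball y (f y).2 `|`
      [set x | exists2 y, y \in t' & ball y (f y).2 x]) <= _)%E).
    apply: hausdorff_content_mono => x [z + zx].
    by rewrite inE => /predU1P[<-|zt']; [left|right; exists z].
  apply: le_trans (hausdorff_contentU _ _ _) _.
  rewrite IH ?adde0; last by move=> z zt'; apply: ty; rewrite inE zt' orbT.
  have [_ y0] := hf y; rewrite (hausdorff_content_eq0 _ _ y0)//.
  by rewrite ler_nat ltnS; apply: leq_bigmax_seq => //; apply: ty; rewrite mem_head.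
have := Xinf N; rewrite (_ : setT = [set x | exists2 y, y \in t & ball y (f y).2 x]).
  by rewrite null// ltxx.
by apply/seteqP; split => // x _; exact: ht.
Qed.

Definition shell x0 (r q : R) := [set x : X | r <= mdist x0 x <= r * q].

Lemma closed_mdist_le x0 (r : R) : closed [set x | mdist x0 x <= r].
Proof.
move=> x clx /=; apply/ler_addgt0Pr => e e0.
have [y [/= yr]] := clx _ (nbhsx_ballx x _ e0).
by rewrite ballEmdist/= metric_sym => xy; have := metric_triangle x0 y x; lra.
Qed.

Lemma closed_mdist_ge x0 (r : R) : closed [set x | r <= mdist x0 x].
Proof.
move=> x clx /=; apply/ler_addgt0Pr => e e0.
have [y [/= yr]] := clx _ (nbhsx_ballx x _ e0).
by rewrite ballEmdist/= => xy; have := metric_triangle x0 x y; lra.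
Qed.

Lemma closed_shell x0 r q : closed (shell x0 r q).
Proof.
rewrite (_ : shell _ _ _ = [set x | r <= mdist x0 x] `&` [set x | mdist x0 x <= r * q]).
  by apply: closedI; [exact: closed_mdist_ge|exact: closed_mdist_le].
by apply/seteqP; split => x /=; [move=> /andP[]|move=> [? ?]; apply/andP].
Qed.

(** If all shells were null, peeling them off would leave arbitrarily small balls with at least the
    content of [ball x0 r], but the gauge of these balls tends to 0. *)
Lemma exists_thick_shell x0 (n : nat) (r q : R) : 0 < r -> 1 < q ->
  (0 < hausdorff_content n.+1%:R (ball x0 r))%E ->
  exists rho, [/\ 0 < rho, rho < r & (0 < hausdorff_content n.+1%:R (shell x0 rho q))%E].
Proof.
move=> r0 q1 ballc; apply: contrapT => nrho.
have q0 : 0 < q by apply: lt_trans q1.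
have null rho : 0 < rho -> rho < r -> hausdorff_content n.+1%:R (shell x0 rho q) = 0%E.
  move=> rho0 rhor; apply: contrapT => /eqP c; apply: nrho; exists rho; split => //.
  by rewrite lt0e c hausdorff_content_ge0.
pose cball m := [set x | mdist x0 x <= r * q ^- m].
have le_cball m : (hausdorff_content n.+1%:R (ball x0 r) <=
    hausdorff_content n.+1%:R (cball m))%E.
  elim: m => [|m IH].
    apply: hausdorff_content_mono => x; rewrite ballEmdist/cball/= expr0 invr1 mulr1.
    exact: ltW.
  apply: le_trans IH _.
  apply: le_trans (_ : (hausdorff_content n.+1%:R
      (shell x0 (r * q ^- m.+1) q `|` cball m.+1) <= _)%E).
    apply: hausdorff_content_mono => x; rewrite /cball/= => xm.
    have [?|/ltW rx] := leP (mdist x0 x) (r * q ^- m.+1); [by right|left].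
    by rewrite /shell/= rx/= -mulrA exprS invfM mulrAC mulVf ?mul1r// gt_eqF.
  apply: le_trans (hausdorff_contentU _ _ _) _; rewrite null ?add0e//.
    by rewrite mulr_gt0// invr_gt0 exprn_gt0.
  by rewrite ltr_pdivrMr ?exprn_gt0// ltr_pMr// exprn_egt1.
have [c c0 cle] : exists2 c, 0 < c &
    (c%:E <= hausdorff_content n.+1%:R (ball x0 r))%E.
  move: ballc; case: hausdorff_content => [c|_|//]; last by exists 1; rewrite ?leey.
  by rewrite lte_fin => c0; exists c.
(* The bound by 1 makes the power [n.+1] of a diameter below [d] no larger than the diameter. *)
pose d := Num.min 1 (c / 2); have d0 : 0 < d by rewrite lt_min ltr01 divr_gt0.
have [|||M /(_ M (leqnn M)) hM] := @exists_expr_le R q^-1 (d / (2 * r)).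
- by rewrite invr_gt0.
- by rewrite invf_lt1.
- by rewrite divr_gt0// mulr_gt0.
have rM0 : 0 <= 2 * (r * q ^- M) by rewrite !mulr_ge0 ?invr_ge0 ?exprn_ge0// ltW.
have rMd : 2 * (r * q ^- M) <= d.
  by move: hM; rewrite exprVn ler_pdivlMr ?mulr_gt0// mulrC mulrA.
have : (c%:E <= d%:E)%E.
  apply: le_trans cle _; apply: le_trans (le_cball M) _.
  apply: le_trans (hausdorff_content_le_gauge _ _) _.
  apply: le_trans (@hausdorff_gauge_le _ _ _ _ _ _ rM0 _) _ => //.
    move=> x y; rewrite /cball/= => xM yM; have := metric_triangle x x0 y.
    by rewrite (metric_sym x x0); lra.
  rewrite lee_fin; apply: (le_trans _ rMd).
  move: rM0; rewrite le_eqVlt => /predU1P[<-|rM0]; first by rewrite powR0 ?pnatr_eq0.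
  apply: ge1r_powR; last by rewrite ler1n.
  by rewrite rM0/=; apply: le_trans rMd _; rewrite ge_min lexx.
rewrite lee_fin; have : d <= c / 2 by rewrite ge_min lexx orbT.
lra.
Qed.

Lemma exists_alternation (b : nat -> bool) m i k : (i <= m)%N -> (k <= m)%N ->
  b i -> ~~ b k -> exists2 j, (j < m)%N & b j != b j.+1.
Proof.
move=> im km bi bk; apply: contrapT => nj.
have const j : (j <= m)%N -> b j = b 0%N.
  elim: j => // j IH jm; rewrite -IH 1?ltnW//; apply/eqP.
  by apply: contrapT => /negP; rewrite eq_sym => ?; apply: nj; exists j.
by move: bi bk; rewrite !const// => ->.
Qed.

(** * Lacunary unions of shells *)

Section lacunary_union.
Variables (x0 : X) (D eta : R) (rho : nat -> R) (S : nat -> set X).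
Hypothesis eta0 : 0 < eta.
Hypothesis eta_half : eta < 2^-1.
Hypothesis D_ge0 : 0 <= D.
Hypothesis etaD : 2 * (1 + eta) <= D * (1 - 2 * eta).
Hypothesis rho0 : forall n, 0 < rho n.
Hypothesis rho_lac : forall n, rho n.+1 < eta * rho n.
Hypothesis closedS : forall n, closed (S n).
Hypothesis shellS : forall n, S n `<=` shell x0 (rho n) (1 + eta).
Hypothesis chainS : forall n, chain_bounded (@mdist R X) (S n) D.

Let union := [set x0] `|` \bigcup_n S n.

Let rho_lt k l : (k < l)%N -> rho l < eta * rho k.
Proof.
elim: l => // l IH; rewrite ltnS leq_eqVlt => /predU1P[->//|/IH lk].
apply: lt_trans (rho_lac l) _; rewrite ltr_pM2l//; apply: lt_trans lk _.
by rewrite gtr_pMl//; have := eta_half; lra.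
Qed.

Let rho_geo n : rho n <= rho 0%N * eta ^+ n.
Proof.
elim: n => [|n IH]; first by rewrite expr0 mulr1.
apply: le_trans (ltW (rho_lac n)) _.
by rewrite exprS mulrCA ler_pM2l.
Qed.

(** The sets [S n] accumulate only at [x0]: near any other point just finitely many of them
    occur. *)
Lemma closed_lacunary_union : closed union.
Proof.
move=> x clx; have [->|xx0] := eqVneq x x0; first by left.
have d0 : 0 < mdist x0 x by rewrite mdist_gt0 eq_sym.
have eta1 : eta < 1 by have := eta_half; lra.
have [|N hN] := @exists_expr_le R eta (mdist x0 x / (4 * rho 0%N)) eta0 eta1.
  by rewrite divr_gt0// mulr_gt0.
have : closed (\bigcup_(n in `I_N) S n).
  by apply: closed_bigcup => //; exact: finite_II.
move=> /(_ x)[|n _ Sx]; last by right; exists n.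
move=> P nP; have e0 : 0 < mdist x0 x / 4 by rewrite divr_gt0.
have [y [Uy [Py]]] := clx _ (filterI nP (nbhsx_ballx x _ e0)).
rewrite ballEmdist/= => xy.
have yx0 : mdist x0 x / 2 < mdist x0 y.
  by have := metric_triangle x0 y x; rewrite (metric_sym y x); lra.
exists y; split => //; case: Uy => [yE|[n _ Sy]].
  by move: yx0; rewrite yE mdistxx; lra.
exists n => //=; rewrite ltnNge; apply/negP => /hN.
rewrite ler_pdivlMr ?mulr_gt0// => hn.
have := rho_geo n; have := shellS Sy => /andP[_ yn] rn.
have : rho n * (1 + eta) <= rho n * 2 by rewrite ler_pM2l//; lra.
move: hn; rewrite mulrCA (mulrC (eta ^+ n)); lra.
Qed.

(** Let [S n] contain the point of the chain farthest from [x0]. Points of the chain outside [S n]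
    are within [2 * eta * rho n] of [x0]. Either the chain stays in [S n], or one of its steps
    crosses the gap, so that [(1 - 2 * eta) * rho n <= r], whereas its ends are at most
    [2 * (1 + eta) * rho n] apart; [etaD] compares the two. *)
Lemma chain_bounded_lacunary_union : chain_bounded (@mdist R X) union D.
Proof.
move=> r m u r0 uU ustep.
pose v i := mdist x0 (u i).
have [i0 _ vmax] := @Order.TotalTheory.arg_maxP _ _ 'I_m.+1 ord0 xpredT
  (fun i : 'I_m.+1 => v i) isT.
have vle i : (i <= m)%N -> v i <= v i0.
  by move=> im; exact: (vmax (Ordinal (im : (i < m.+1)%N))).
have i0m : (i0 <= m)%N by rewrite -ltnS ltn_ord.
have tri : mdist (u 0%N) (u m) <= v 0%N + v m.
  by have := metric_triangle (u 0%N) x0 (u m); rewrite (metric_sym _ x0).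
case: (uU i0 i0m) => [ui0|[n _ Sn]].
  have v0 i : (i <= m)%N -> v i <= 0 by move=> /vle; rewrite /v ui0 mdistxx.
  apply: le_trans tri _; have := v0 0%N isT; have := v0 m (leqnn m).
  have := mulr_ge0 D_ge0 r0; lra.
have /andP[nv vn] := shellS Sn; have rn := rho0 n.
have vle' i : (i <= m)%N -> v i <= rho n * (1 + eta).
  by move=> /vle /le_trans; apply.
have eta2 : eta * (1 + eta) < 2 * eta.
  by rewrite mulrC ltr_pM2r//; have := eta_half; lra.
have inS i : (i <= m)%N -> rho n <= v i -> S n (u i).
  move=> im; case: (uU i im) => [ui|[k _ Sk]].
    by rewrite /v ui mdistxx leNgt rn.
  have /andP[kv vk] := shellS Sk; have [nk|kn|nk] := ltngtP n k; last by rewrite nk.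
    rewrite leNgt => /negP[]; apply: le_lt_trans vk _.
    apply: lt_trans (_ : eta * rho n * (1 + eta) < _).
      by rewrite ltr_pM2r ?rho_lt// addr_gt0.
    rewrite mulrAC -[ltRHS]mul1r ltr_pM2r//; have := eta_half; lra.
  have := rho_lt kn; have := vle' i im => h1 h2.
  have : eta * (rho n * (1 + eta)) < rho n.
    rewrite mulrCA -[ltRHS]mulr1 ltr_pM2l//; have := eta_half; lra.
  have : eta * rho k <= eta * (rho n * (1 + eta)).
    by rewrite ler_pM2l// (le_trans kv).
  lra.
have out i : (i <= m)%N -> v i < rho n -> v i <= 2 * eta * rho n.
  move=> im vi; case: (uU i im) => [ui|[k _ Sk]].
    by rewrite /v ui mdistxx !mulr_ge0// ltW.
  have /andP[kv vk] := shellS Sk.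
  have nk : (n < k)%N.
    rewrite ltnNge leq_eqVlt; apply/negP => /predU1P[kn|kn].
      by move: vi; rewrite -kn ltNge kv.
    have := rho_lt kn; have : eta * rho k <= rho k.
      by rewrite ler_piMl ?ltW//; have := eta_half; lra.
    move: vi; rewrite /v; lra.
  apply: le_trans vk _; apply: le_trans (_ : eta * rho n * (1 + eta) <= _).
    by rewrite ler_pM2r ?addr_gt0//; exact/ltW/rho_lt.
  by rewrite mulrAC ler_pM2r// ltW.
have [/existsP[k vk]|] := boolP [exists k : 'I_m.+1, v k < rho n]; last first.
  rewrite negb_exists => /forallP all_in.
  apply: (chainS r0 _ ustep) => i im; apply: inS => //.
  by have := all_in (Ordinal (im : (i < m.+1)%N)); rewrite -leNgt.
have km : (k <= m)%N by rewrite -ltnS ltn_ord.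
have [j jm bj] : exists2 j, (j < m)%N & (rho n <= v j) != (rho n <= v j.+1).
  by apply: (exists_alternation i0m km nv); rewrite -ltNge.
have rstep : (1 - 2 * eta) * rho n <= r.
  have := ustep j jm => hs; have jm1 := ltnW jm.
  have t1 := metric_triangle x0 (u j) (u j.+1).
  have t2 := metric_triangle x0 (u j.+1) (u j).
  rewrite (metric_sym (u j.+1)) in t2.
  have := out j jm1; have := out j.+1 jm; rewrite /v in bj *; move: bj.
  case: (leP (rho n) (mdist x0 (u j))) => // h1;
    case: (leP (rho n) (mdist x0 (u j.+1))) => // h2 _.
  + by move=> /(_ isT) h3 _; lra.
  + by move=> _ /(_ isT) h3; lra.
have h1 := vle' 0%N isT; have h2 := vle' m (leqnn m).
apply: le_trans tri _; apply: le_trans (_ : D * ((1 - 2 * eta) * rho n) <= _).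
  rewrite mulrA; apply: le_trans (_ : 2 * (1 + eta) * rho n <= _); first lra.
  by rewrite ler_pM2r.
exact: ler_wpM2l.
Qed.

End lacunary_union.

End infinite_dimension.

(** * Dimension of the skeleton *)

Section skeleton_dimension.
Variables (R : realType) (X : metricType R) (a D tau : R) (H : nat).
Hypothesis cX : compact [set: X].
Hypothesis a0 : 0 < a.
Hypothesis aD : 2 <= D * a.
Hypothesis tau0 : 0 < tau.
Hypothesis tau1 : tau < 1.
Hypothesis H0 : (0 < H)%N.
Hypothesis tau_sep : tau ^+ H.+1 + a <= tau.

(** A single skeleton only reaches a finite exponent. The skeleton in the [n]-th shell around [x0]
    has dimension at least [n.+1 / H.+1], and their union collects all of these. *)
Lemma exists_skeleton_infinite_dim : hausdorff_dim [set: X] = +oo%E ->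
  exists S : set X, [/\ closed S, chain_bounded (@mdist R X) S D &
    hausdorff_dim S = +oo%E].
Proof.
move=> Xoo.
have D_gt2 : 2 < D.
  have a1 : a < 1 by have := exprn_gt0 H.+1 tau0; have := tau_sep; have := tau1; lra.
  have D0 : 0 < D.
    have : 0 < D * a by apply: lt_le_trans aD.
    by rewrite pmulr_lgt0.
  by apply: le_lt_trans aD _; rewrite gtr_pMr.
have D0 : 0 <= D by lra.
have [x0 hx0] : exists x0 : X, forall (n : nat) r, 0 < r ->
    (0 < hausdorff_content n.+1%:R (ball x0 r))%E.
  apply: (exists_everywhere_thick cX) => n.
  by apply: hausdorff_content_gt0; rewrite ?ler0n// Xoo ltry.
(* The solution of [2 * (1 + eta) = D * (1 - 2 * eta)], positive since [2 < D]. *)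
pose eta := (D - 2) / (2 * (D + 1)).
have D1 : 0 < 2 * (D + 1) by lra.
have eta0 : 0 < eta by rewrite divr_gt0// subr_gt0.
have etaE : eta * (2 * (D + 1)) = D - 2 by rewrite divfK ?gt_eqF.
have eta_half : eta < 2^-1 by rewrite ltr_pdivrMr//; lra.
have etaD : 2 * (1 + eta) <= D * (1 - 2 * eta) by lra.
have q1 : 1 < 1 + eta by rewrite ltrDl.
have /choice[f hf] : forall nr : nat * R, exists rho, 0 < nr.2 ->
    [/\ 0 < rho, rho < nr.2 &
        (0 < hausdorff_content nr.1.+1%:R (shell x0 rho (1 + eta)))%E].
  move=> [n r]; have [r0|_] := boolP (0 < r); last by exists 0 => /=.
  by have [rho hrho] := exists_thick_shell r0 q1 (hx0 n r r0); exists rho.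
pose rho := fix rho n := if n is n'.+1 then f (n, eta * rho n') else f (0%N, 1).
have rho0 n : 0 < rho n.
  elim: n => [|n IH]; first by have [] := hf (0%N, 1) ltr01.
  by have [] := hf (n.+1, eta * rho n) (mulr_gt0 eta0 IH).
have rho_lac n : rho n.+1 < eta * rho n.
  by have [] := hf (n.+1, eta * rho n) (mulr_gt0 eta0 (rho0 n)).
have rho_thick n : (0 < hausdorff_content n.+1%:R (shell x0 (rho n) (1 + eta)))%E.
  case: n => [|n]; first by have [] := hf (0%N, 1) ltr01.
  by have [] := hf (n.+1, eta * rho n) (mulr_gt0 eta0 (rho0 n)).
have /choice[S hS] : forall n, exists S : set X,
    [/\ closed S, S `<=` shell x0 (rho n) (1 + eta),
        chain_bounded (@mdist R X) S D &
        (0 < hausdorff_content (n.+1%:R / H.+1%:R) S)%E].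
  move=> n; have n0 : 0 < (n.+1%:R : R) by rewrite ltr0n.
  exact: (exists_skeleton cX (@closed_shell R X x0 (rho n) (1 + eta)) n0
    a0 aD tau0 tau1 H0 tau_sep (rho_thick n)).
have closedS n : closed (S n) by have [] := hS n.
have shellS n : S n `<=` shell x0 (rho n) (1 + eta) by have [] := hS n.
have chainS n : chain_bounded (@mdist R X) (S n) D by have [] := hS n.
exists ([set x0] `|` \bigcup_n S n); split.
- exact: closed_lacunary_union eta0 eta_half rho0 rho_lac closedS shellS.
- exact: chain_bounded_lacunary_union eta0 eta_half D0 etaD rho0 rho_lac shellS chainS.
apply: eq_infty => r.
have [n rn] : exists n : nat, r <= n.+1%:R / H.+1%:R.
  have /truncn_itv/andP[_] : 0 <= `|r * H.+1%:R| by [].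
  move=> rn; exists (Num.truncn `|r * H.+1%:R|).
  by rewrite ler_pdivlMr ?ltr0n// (le_trans (ler_norm _))// ltW.
apply: le_trans (_ : ((n.+1%:R / H.+1%:R)%:E <= _)%E); first by rewrite lee_fin.
apply: le_hausdorff_dim; first by rewrite divr_gt0 ?ltr0n.
have [_ _ _ /lt_le_trans] := hS n; apply; apply: hausdorff_content_mono.
by move=> x Sx; right; exists n.
Qed.

(** For a finite dimension [d > 0] the exponent [d / 2] has positive content, which accounts for the
    factor 2; for [d = 0] the empty set will do. *)
Lemma exists_skeleton_dim : exists S : set X,
  [/\ closed S, chain_bounded (@mdist R X) S D &
    ((2 * H.+1%:R)^-1%:E * hausdorff_dim [set: X] <= hausdorff_dim S)%E].
Proof.
have dim_ge0 (A : set X) : (0 <= hausdorff_dim A)%E.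
  by apply: le_ereal_inf_tmp => _ [s [s0 _] <-]; rewrite lee_fin.
have H20 : 0 < (2 * H.+1%:R : R) by rewrite mulr_gt0 ?ltr0n.
have := dim_ge0 [set: X]; case dimX : (hausdorff_dim [set: X]) => [d||//]; last first.
  move=> _; have [S [clS chS dimS]] := exists_skeleton_infinite_dim dimX.
  by exists S; split => //; rewrite dimS leey.
rewrite lee_fin le_eqVlt => /predU1P[<-|d0].
  exists set0; split; first exact: closed0.
    by move=> rho n u _ /(_ 0%N isT).
  by rewrite mule0.
have s0 : 0 < d / 2 by rewrite divr_gt0.
have content_gt0 : (0 < hausdorff_content (d / 2) [set: X])%E.
  by apply: hausdorff_content_gt0; [exact: ltW|rewrite dimX lte_fin; lra].
have [S [clS _ chS cS]] :=
  exists_skeleton cX (@closedT X) s0 a0 aD tau0 tau1 H0 tau_sep content_gt0.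
exists S; split => //; apply: le_trans (le_hausdorff_dim _ cS).
  by rewrite -EFinM lee_fin invfM mulrC mulrA.
by rewrite !divr_gt0 ?ltr0n.
Qed.

End skeleton_dimension.

(** * Embedding in sequence spaces *)

Section label_vectors.
Variables (R : realType) (p : R) (p1 : 1 <= p).

Lemma exists_ellp (u : nat -> R) :
  (\sum_(n <oo) (`|u n| `^ p)%:E < +oo)%E ->
  exists v : ellp p1, forall n, v n = u n.
Proof.
move=> uoo.
have uL : u \in Lfun (counting : {measure set nat -> \bar R}) p%:E.
  rewrite inE/=; apply/andP; split; first by rewrite inE.
  rewrite inE/= /finite_norm Lnorm_counting ?(lt_le_trans ltr01)//.
  exact: poweR_lty.
by exists (Lfun_Sub (ellp_exponent_ge1 p1) uL).
Qed.

Variable T : nat -> R.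
Hypothesis T_decr : forall k, T k.+1 <= T k.
Hypothesis T_cvg : T @ \oo --> 0.

(** A level at which two labels differ contributes two coordinates, so each receives half of the
    increment [T k - T k.+1]. *)
Let b k := ((T k - T k.+1) / 2) `^ p^-1.

Let p0 : 0 < p. Proof. exact: lt_le_trans p1. Qed.

Let b_ge0 k : 0 <= b k. Proof. exact: powR_ge0. Qed.

Let bp k : b k `^ p = (T k - T k.+1) / 2.
Proof.
rewrite -powRrM mulVf ?gt_eqF// powRr1// divr_ge0// subr_ge0.
exact: T_decr.
Qed.

(* Coordinates are pairs (level, label), encoded in nat; pickle_inv rather than
   unpickle makes the encoding of a coordinate unique. *)
Definition label_vector (l : nat -> nat) (n : nat) : R :=
  if @pickle_inv (nat * nat)%type n is Some ki then
    if l ki.1 == ki.2 then b ki.1 else 0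
  else 0.

Let code (l : nat -> nat) k : nat := pickle (k, l k).

Let label_vector_code l l' k :
  label_vector l' (code l k) = if l' k == l k then b k else 0.
Proof. by rewrite /label_vector /code pickleK_inv. Qed.

Let tail (l : nat -> nat) k0 := [set code l (k0 + i)%N | i in [set: nat]].

Let esum_tail l k0 (g : nat -> \bar R) :
  (forall k, (k0 <= k)%N -> g (code l k) = ((T k - T k.+1) / 2)%:E) ->
  (\esum_(n in tail l k0) g n = (T k0 / 2)%:E)%E.
Proof.
move=> gE; rewrite esum_image; last first.
  move=> i j _ _ /(pcan_inj pickleK)[/eqP].
  by rewrite eqn_add2l => /eqP.
rewrite (eq_esum (b := fun i => ((T (k0 + i)%N - T (k0 + i).+1) / 2)%:E)); last first.
  by move=> i _; rewrite gE// leq_addr.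
rewrite -nneseries_esumT; last first.
  by move=> i; rewrite lee_fin divr_ge0// subr_ge0 T_decr.
apply/cvg_lim => //.
rewrite (_ : (fun n => _) = EFin \o (fun n => (T k0 - T (k0 + n)%N) / 2)); last first.
  apply/funext => n /=; rewrite sumEFin; congr EFin.
  elim: n => [|n IH]; first by rewrite big_nil addn0 subrr mul0r.
  by rewrite big_nat_recr//= IH addnS -mulrDl addrA subrK.
apply: cvg_EFin; first by near=> n.
have -> : T k0 / 2 = (T k0 - 0) / 2 by rewrite subr0.
apply: cvgMr_tmp; apply: cvgB; first exact: cvg_cst.
rewrite (_ : (fun n => _) = (fun n => T (n + k0)%N)); last first.
  by apply/funext => n; rewrite addnC.
by rewrite cvg_shiftn.
Unshelve. all: by end_near. Qed.

Lemma label_vector_sum l : (\sum_(n <oo) (`|label_vector l n| `^ p)%:E < +oo)%E.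
Proof.
rewrite nneseries_esumT => [|n]; last by rewrite lee_fin powR_ge0.
rewrite (esumID (tail l 0)) => [|n _]; last by rewrite lee_fin powR_ge0.
rewrite setTI setTI (esum_tail (l := l)); last first.
  by move=> k _; rewrite label_vector_code eqxx ger0_norm// bp.
rewrite esum1 ?adde0 ?ltry// => n /= ntail.
rewrite /label_vector; case E : pickle_inv => [[k i]|]; last first.
  by rewrite normr0 powR0// gt_eqF.
case: eqP => /= li; last by rewrite normr0 powR0// gt_eqF.
exfalso; apply: ntail; exists k => //.
by have := @pickle_invK (nat * nat)%type n; rewrite E/= /code add0n li.
Qed.

(** The vectors differ exactly on the codes of [l] and of [l'] from level [k0] on, up to zero
    weights. These two sets are disjoint, and each contributes [T k0 / 2] by telescoping. *)
Lemma label_vector_dist l l' k0 : (forall k, (k < k0)%N -> l k = l' k) ->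
  (forall k, (k0 <= k)%N -> l k <> l' k) ->
  (\sum_(n <oo) (`|label_vector l n - label_vector l' n| `^ p)%:E = (T k0)%:E)%E.
Proof.
move=> below above.
pose g n := (`|label_vector l n - label_vector l' n| `^ p)%:E; rewrite -/g.
have g0 n : (0 <= g n)%E by rewrite /g lee_fin powR_ge0.
rewrite nneseries_esumT// (esumID (tail l k0))// setTI setTI.
rewrite (esumID (tail l' k0) (~` tail l k0))//.
have -> : ~` tail l k0 `&` tail l' k0 = tail l' k0.
  apply/setIidPr => _ [i _ <-] [j _ /(pcan_inj pickleK)[/eqP]].
  by rewrite eqn_add2l => /eqP-> /above; apply; exact: leq_addr.
rewrite (esum_tail (l := l)); last first.
  move=> k k0k; rewrite /g !label_vector_code eqxx ifF.
    by rewrite subr0 ger0_norm// bp.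
  by apply/eqP => ll; apply: (above k).
rewrite (esum_tail (l := l')); last first.
  move=> k k0k; rewrite /g !label_vector_code eqxx ifF.
    by rewrite sub0r normrN ger0_norm// bp.
  exact/eqP/above.
rewrite esum1 ?adde0 -?EFinD -?splitr// => n /= [ntail ntail'].
change (g n = 0%E).
suff -> : g n = (`|0 : R| `^ p)%:E by rewrite normr0 powR0// gt_eqF.
rewrite /g; congr (`|_| `^ _)%:E; rewrite /label_vector.
have := @pickle_invK (nat * nat)%type n.
case E : pickle_inv => [[k i]|]/=; last by rewrite subr0.
move=> kin; have [kk0|k0k] := ltnP k k0.
  by rewrite (below _ kk0) subrr.
have [li|_] := eqVneq (l k) i.
  by exfalso; apply: ntail; exists (k - k0)%N; rewrite // /code subnKC// li.
have [li|_] := eqVneq (l' k) i; last by rewrite subr0.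
by exfalso; apply: ntail'; exists (k - k0)%N; rewrite // /code subnKC// li.
Qed.

End label_vectors.

Section embedding.
Variables (R : realType) (X : metricType R) (S : set X).

(* The equivalence relation generated by the steps of length at most t in S. *)
Definition step_connected (t : R) (x y : X) := forall P : set X, P x ->
  (forall u v, S u -> S v -> mdist u v <= t -> P u -> P v) -> P y.

Lemma step_connected_trans t y x z :
  step_connected t x y -> step_connected t y z -> step_connected t x z.
Proof. by move=> xy yz P Px Pstep; exact: (yz P (xy P Px Pstep) Pstep). Qed.

Lemma step_connected_step t x y : S x -> S y -> mdist x y <= t ->
  step_connected t x y.
Proof. by move=> Sx Sy xy P Px Pstep; exact: (Pstep x y). Qed.

Lemma step_connected_sym t x y : step_connected t x y -> step_connected t y x.
Proof.
move=> xy; apply: (xy (fun z => step_connected t z x)) => // u v Su Sv uv.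
apply: step_connected_trans; apply: step_connected_step => //.
by rewrite metric_sym.
Qed.

Lemma step_connected_le t t' x y : t <= t' ->
  step_connected t x y -> step_connected t' x y.
Proof.
move=> tt' xy P Px Pstep; apply: xy => // u v Su Sv uv.
by apply: Pstep => //; exact: le_trans tt'.
Qed.

Lemma step_connected_mdist D t x y : 0 <= t -> chain_bounded (@mdist R X) S D ->
  S x -> step_connected t x y -> mdist x y <= D * t.
Proof.
move=> t0 chS Sx xy.
have [m [u [<- <- uS ustep]]] : exists m (u : nat -> X), [/\ u 0%N = x, u m = y,
    forall i, (i <= m)%N -> S (u i) &
    forall i, (i < m)%N -> mdist (u i) (u i.+1) <= t].
  apply: (xy (fun z => exists m (u : nat -> X), [/\ u 0%N = x, u m = z,
    forall i, (i <= m)%N -> S (u i) &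
    forall i, (i < m)%N -> mdist (u i) (u i.+1) <= t])).
    by exists 0%N, (fun=> x).
  move=> v w Sv Sw vw [m [u [u0 um uS ustep]]].
  exists m.+1, (fun i => if (i <= m)%N then u i else w); split => //.
  - by rewrite ltnn.
  - by move=> i _; case: ifP => // im; exact: uS.
  - move=> i; rewrite ltnS => im; rewrite im; case: ltnP => im1; first exact: ustep.
    have -> : i = m by apply/eqP; rewrite eqn_leq im.
    by rewrite um.
exact: (chS t m u).
Qed.

(** Points of [S] in a common ball of radius [t / 2] are equivalent, so there are finitely many
    classes; the label is the position of the first representative connected to the point. *)
Lemma exists_labels (t : R) : compact [set: X] -> 0 < t ->
  exists c : X -> nat, forall x y, S x -> S y -> c x = c y <-> step_connected t x y.
Proof.
move=> cX t0.
have [x|z0 hz] := @compact_finite_cover X (fun x => ball x (t / 2)) cX.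
  by apply: nbhsx_ballx; rewrite divr_gt0.
(* The centres may lie outside [S] and are replaced by points of [S] in the same balls. *)
have [z1 hz1] : exists z1 : seq X, forall x, S x ->
    exists2 z, z \in z1 & step_connected t z x.
  have /choice[f hf] : forall z, exists y, (exists2 x, S x & ball z (t / 2) x) ->
      S y /\ ball z (t / 2) y.
    move=> z; have [[x Sx zx]|nz] := pselect (exists2 x, S x & ball z (t / 2) x).
      by exists x.
    by exists z.
  exists (map f z0) => x Sx; have [z zz0 zx] := hz x.
  have [Sf zf] := hf z (ex_intro2 _ _ x Sx zx).
  exists (f z); first exact: map_f.
  apply: step_connected_step => //; move: zx zf; rewrite !ballEmdist/=.
  have := metric_triangle (f z) z x; rewrite (metric_sym (f z) z); lra.
pose P x z := `[< step_connected t z x >].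
exists (fun x => find (P x) z1) => x y Sx Sy; split => [xy|xy]; last first.
  apply: eq_find => z; apply/asboolP/asboolP => zx.
    exact: step_connected_trans zx xy.
  exact: step_connected_trans zx (step_connected_sym xy).
have hasP w : S w -> has (P w) z1.
  by move=> /hz1[z zz1 zw]; apply/hasP; exists z => //; apply/asboolP.
have /asboolP zx := nth_find x (hasP x Sx).
have /asboolP zy := nth_find x (hasP y Sy).
by rewrite -xy in zy; exact: step_connected_trans (step_connected_sym zx) zy.
Qed.

(* The vector of x records at each level k, with the weight making the sums
   telescope, the class of x under steps of length at most R0 lam^-k; hence two
   points first separated at level k have images at distance R0 lam^-k. *)
Lemma embeds_ellp (p : R) (p1 : 1 <= p) (D lam D' : R) :
  compact [set: X] -> chain_bounded (@mdist R X) S D -> 0 < D -> 1 < lam ->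
  D * lam <= D' -> embeds_with_distortion S (ellp p1) D'.
Proof.
move=> cX chS D0 lam1 DD'.
have [R0 R00 diamX] := compact_mdist_bounded cX.
have lam0 : 0 < lam by apply: lt_trans lam1.
have p0 : 0 < p by apply: lt_le_trans p1.
pose t k := R0 * lam^-1 ^+ k.
have laminv : 0 < lam^-1 by rewrite invr_gt0.
have laminv1 : lam^-1 < 1 by rewrite invf_lt1.
have t0 k : 0 < t k by rewrite mulr_gt0 ?exprn_gt0.
have t_decr k l : (k <= l)%N -> t l <= t k.
  by move=> kl; rewrite ler_pM2l//; apply: ler_wiXn2l => //; exact: ltW.
(* Here [T k] is the [p]-th power of [t k], so the distance of two images is some [t k0]. *)
pose r := lam^-1 `^ p; pose T k := R0 `^ p * r ^+ k.
have r0 : 0 < r by exact: powR_gt0.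
have r1 : r < 1.
  rewrite -(powRr0 lam^-1) /r; have := gt0_ltr_powR p0 _ _ laminv1.
  by rewrite powR1 powRr0; apply; rewrite nnegrE// ltW.
have tT k : T k `^ p^-1 = t k.
  have -> : T k = t k `^ p.
    rewrite /t powRM ?exprn_ge0 ?ltW// /T /r; congr (_ * _).
    by rewrite -powR_mulrn ?powR_ge0// powRAC powR_mulrn ?(ltW laminv).
  by rewrite -powRrM divff ?gt_eqF// powRr1// ltW.
have T_decr k : T k.+1 <= T k.
  by rewrite ler_pM2l ?powR_gt0// exprS ler_piMl ?exprn_ge0 ?ltW.
have T_cvg : T @ \oo --> 0.
  rewrite -[0](mulr0 (R0 `^ p)); apply: cvgMl_tmp; apply: cvg_expr.
  by rewrite gtr0_norm.
have /choice[c hc] := fun k => exists_labels cX (t0 k).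
have /choice[f hf] : forall x, exists v : ellp p1,
    forall n, v n = label_vector p T (c^~ x) n.
  by move=> x; apply: exists_ellp; exact: label_vector_sum.
exists f, (D * lam)^-1; split; first by rewrite invr_gt0 mulr_gt0.
move=> x y Sx Sy; have [<-|xy] := eqVneq x y; first by rewrite !mdistxx !mulr0 lexx.
have dxy : 0 < mdist x y by rewrite mdist_gt0.
have ex : exists k, ~~ `[< step_connected (t k) x y >].
  have [|||k /(_ k (leqnn k)) hk] :=
      @exists_expr_le R lam^-1 (mdist x y / (2 * (D * R0))) => //.
    by rewrite divr_gt0// !mulr_gt0.
  exists k; apply/asboolP => /(step_connected_mdist (ltW (t0 k)) chS Sx).
  move: hk; rewrite ler_pdivlMr ?mulr_gt0// /t => hk; apply/negP; rewrite -ltNge.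
  have -> : D * (R0 * lam^-1 ^+ k) = lam^-1 ^+ k * (2 * (D * R0)) / 2 by field.
  lra.
case: (ex_minnP ex) => k0 /asboolP nk0 k0min.
have conn k : (k < k0)%N -> step_connected (t k) x y.
  move=> kk0; apply: contrapT => /asboolPn nk.
  by have := k0min k nk; rewrite leqNgt kk0.
have fdist : mdist (f x) (f y) = t k0.
  apply/EFin_inj; rewrite ellp_mdistE.
  under eq_eseriesr do rewrite !hf.
  rewrite (@label_vector_dist R p p1 T T_decr T_cvg _ _ k0).
  - by rewrite poweR_EFin tT.
  - by move=> k /conn; apply: (hc k x y Sx Sy).2.
  - move=> k k0k /(hc k x y Sx Sy) kxy; apply: nk0.
    exact: step_connected_le (t_decr _ _ k0k) kxy.
(* All of [S] is connected at level 0, so level [k0.-1] exists and connects [x] to [y]; this bounds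
   [mdist x y] by [D * t k0.-1 = D * lam * t k0]. *)
have k0_gt0 : (0 < k0)%N.
  rewrite lt0n; apply/eqP => k00; apply: nk0; apply: step_connected_step => //.
  by rewrite k00 /t expr0 mulr1.
have upper : t k0 <= mdist x y.
  by rewrite leNgt; apply/negP => /ltW ?; apply: nk0; exact: step_connected_step.
have lower : mdist x y <= D * lam * t k0.
  have := step_connected_mdist (ltW (t0 k0.-1)) chS Sx.
  rewrite -{1}(prednK k0_gt0) in conn; move=> /(_ y (conn _ (ltnSn _))).
  rewrite -[in t k0](prednK k0_gt0) /t exprS => /le_trans; apply.
  rewrite le_eqVlt; apply/orP; left; apply/eqP; field.
  by rewrite gt_eqF.
have Dlam0 : 0 < D * lam by rewrite mulr_gt0.
rewrite fdist; apply/andP; split; first by rewrite ler_pdivrMl.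
apply: le_trans upper _; rewrite -[leLHS]mul1r ler_pM2r//.
by rewrite ler_pdivlMr// mul1r.
Qed.

End embedding.

(** * Choice of parameters and conclusion *)

(** With [x = e / 16] and [H] the integer part of [L = ln (1 / x) / x], the first bound is
    [(1 - x) ^ H.+1 <= exp (- x * L) = x]. For the second, [1 <= L] and
    [ln (1 / x) <= 5 * ln (1 / e)] give [2 * H.+1 <= 4 * L <= 320 * ln (1 / e) / e]. *)
Lemma exists_branching_delay (R : realType) (e : R) : 0 < e -> e <= 2^-1 ->
  exists2 H : nat, (0 < H)%N &
    (1 - e / 16) ^+ H.+1 <= e / 16 /\
    320^-1 * e / ln (1 / e) <= (2 * H.+1%:R)^-1.
Proof.
move=> e0 e1; pose x := e / 16; pose L := x^-1 * ln x^-1.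
have x0 : 0 < x by rewrite divr_gt0.
have ln2 : 2^-1 <= ln (2 : R).
  have := expR_ge1Dx (- ln (2 : R)); rewrite expRN lnK ?posrE//; lra.
have lne : ln 2 <= ln (1 / e).
  by rewrite ler_ln ?posrE ?divr_gt0// ler_pdivlMr//; lra.
have lnx : ln x^-1 = 4 * ln 2 + ln (1 / e).
  have -> : x^-1 = 2 ^+ 4 * (1 / e) by rewrite /x; field; rewrite gt_eqF.
  by rewrite lnM ?posrE ?divr_gt0 ?exprn_gt0// lnXn// -(mulr_natl (ln 2)).
have xinv : 32 <= x^-1.
  by rewrite -[32]invrK lef_pV2 ?posrE ?invr_gt0// /x; lra.
have L1 : 1 <= L.
  have lnx0 : 0 < ln x^-1 by lra.
  by apply: le_trans (_ : 32 * ln x^-1 <= _); [lra|rewrite ler_pM2r].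
have L0 : 0 <= L by lra.
have /andP[HL LH] := truncn_itv L0.
set H := Num.truncn L in HL LH; exists H.
  by rewrite /H truncn_gt0.
split.
  apply: le_trans (_ : expR (- x) ^+ H.+1 <= _).
    apply: lerXn2r; rewrite ?nnegrE ?expR_ge0//; first by rewrite /x; lra.
    by have := expR_ge1Dx (- x).
  rewrite -expRM_natl -[leRHS]lnK ?posrE// ler_expR -/x mulrN.
  rewrite lerNl -lnV ?posrE// -ler_pdivrMr//.
  by rewrite mulrC ltW.
have lne0 : 0 < ln (1 / e) by lra.
have -> : 320^-1 * e / ln (1 / e) = (320 * (ln (1 / e) / e))^-1.
  by field; rewrite !gt_eqF.
rewrite lef_pV2 ?posrE ?mulr_gt0 ?divr_gt0 ?invr_gt0 ?ltr0n//.
have -> : 320 * (ln (1 / e) / e) = 4 * (x^-1 * (5 * ln (1 / e))).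
  by rewrite /x; field; rewrite gt_eqF.
have : L <= x^-1 * (5 * ln (1 / e)) by rewrite ler_pM2l ?invr_gt0// lnx; lra.
rewrite -natr1; lra.
Qed.

(* The factor eps / log(1/eps) is meant for eps bounded away from 1: it blows
   up as eps tends to 1 from below (where the inequality would contradict
   dim S <= dim X) and is undefined or negative afterwards.  It is therefore
   evaluated at min(eps, 1/2); for eps <= 1/2 this is the formula verbatim. *)
Theorem corollary3p2 (R : realType) :
  exists c : R, 0 < c /\
    forall (p : R) (p1 : 1 <= p) (eps : R), 0 < eps ->
    forall X : metricType R, compact [set: X] ->
    exists S : set X,
      [/\ closed S,
          embeds_with_distortion S (ellp p1) (2 + eps) &
          let e := Num.min eps 2^-1 in
          ((c * e / ln (1 / e))%:E * hausdorff_dim [set: X]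
             <= hausdorff_dim S)%E].
Proof.
exists 320^-1; split; first by rewrite invr_gt0 ltr0n.
move=> p p1 eps eps0 X cX; set e := Num.min eps 2^-1.
have e0 : 0 < e by rewrite lt_min eps0 invr_gt0/=.
have e1 : e <= 2^-1 by rewrite ge_min lexx orbT.
have e_eps : e <= eps by rewrite ge_min lexx.
have [H H0 [tauH cH]] := exists_branching_delay e0 e1.
(* With [tau = 1 - e / 16] the difference [tau - a] is [e / 16], the bound on [tau ^ H.+1]. *)
pose a := 1 - e / 8; have a0 : 0 < a by rewrite /a; lra.
have aD : 2 <= 2 / a * a by rewrite divfK ?gt_eqF.
have tau0 : 0 < 1 - e / 16 by lra.
have tau1 : 1 - e / 16 < 1 by lra.
have tau_sep : (1 - e / 16) ^+ H.+1 + a <= 1 - e / 16 by rewrite /a; lra.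
have [S [clS chS dimS]] := exists_skeleton_dim cX a0 aD tau0 tau1 H0 tau_sep.
exists S; split => //.
  apply: (embeds_ellp p1 (lam := 1 + e / 16) cX chS).
  - by rewrite divr_gt0.
  - by rewrite ltrDl divr_gt0.
  (* The distortion [(2 / a) * (1 + e / 16)] is at most [2 + e], by [e * e <= e / 2]. *)
  - have ee : e * e <= e * 2^-1 by rewrite ler_pM2l.
    apply: le_trans (_ : 2 + e <= _); last by rewrite lerD2l.
    by rewrite mulrAC ler_pdivrMr// /a; lra.
apply: le_trans dimS; apply: lee_wpmul2r; last by rewrite lee_fin.
by apply: le_ereal_inf_tmp => _ [s [s0 _] <-]; rewrite lee_fin.
Qed.
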